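(* Let $m>1$, let $\Omega\subset\mathbb R^n$ be a bounded open set, let $T>0$, and let $\Omega_T=\Omega\times(0,T)$. Let $\psi\colon\Omega_T\to[0,\infty)$ be a non-negative, bounded, and lower semicontinuous function. Then there exists a unique solution $u$ to the obstacle problem for the porous medium equation $\partial_t u-\Delta u^m=0$ with obstacle $\psi$; that is, there exists a unique function $u\colon\Omega_T\to[0,\infty]$ such that (1) $u\ge\psi$ in $\Omega_T$; (2) $u$ is $m$-supercaloric in $\Omega_T$; (3) if $v$ is any $m$-supercaloric function in $\Omega_T$ with $v\ge\psi$ in $\Omega_T$, then $v\ge u$ in $\Omega_T$.
   Context: The porous medium equation is $\partial_t u-\Delta u^m=0$, with $m>1$ throughout. Cylinders. For an open set $U\subset\mathbb R^n$ and $t_1<t_2$, write $U_{t_1,t_2}=U\times(t_1,t_2)$. $U_{t_1,t_2}\Subset\Omega_T$ means $\overline{U_{t_1,t_2}}\subset\Omega_T$. The parabolic boundary is $\partial_pU_{t_1,t_2}=(\partial U\times(t_1,t_2))\cup(\overline U\times\{t_1\})$. Weak solutions. A non-negative function $w\colon U_{t_1,t_2}\to[0,\infty]$ is a weak supersolution to the porous medium equation in $U_{t_1,t_2}$ if $w^m\in L^2_{\rm loc}(t_1,t_2;H^1_{\rm loc}(U))$ and $\iint_{U_{t_1,t_2}}(-w\,\partial_t\varphi+\nabla w^m\cdot\nabla\varphi)\,dx\,dt\ge0$ for every $\varphi\in C_0^\infty(U_{t_1,t_2})$ with $\varphi\ge0$. It is a weak subsolution if the inequality is reversed, and a weak solution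 if it is both. $m$-supercaloric functions. A function $u\colon\Omega_T\to[0,\infty]$ is $m$-supercaloric if (1) $u$ is lower semicontinuous; (2) $u$ is finite in a dense subset of $\Omega_T$; (3) for every cylinder $U_{t_1,t_2}\Subset\Omega_T$: if $w\in C^0(\overline{U_{t_1,t_2}})$ is a weak solution to the porous medium equation in $U_{t_1,t_2}$ and $u\ge w$ on $\partial_pU_{t_1,t_2}$, then $u\ge w$ in $U_{t_1,t_2}$. *)

(* Defs.v *)
From HB Require Import structures.
From mathcomp Require Import all_boot all_order all_algebra.
From mathcomp Require Import all_classical all_reals all_analysis measurable_realfun.

Set Implicit Arguments.
Unset Strict Implicit.
Unset Printing Implicit Defensive.

Import Order.TTheory GRing.Theory Num.Theory.
Import numFieldNormedType.Exports.

Local Open Scope classical_set_scope.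
Local Open Scope ring_scope.

(* The sigma-algebra on R^n = 'rV[R]_n is generated by the coordinates, as the
   library does for tuples; it is the Borel sigma-algebra. *)
Section measurable_rV.
Context {R : realType} (n : nat).

Definition rV_coord (i : 'I_n) (x : 'rV[R]_n) : measurableTypeR R := x ord0 i.

Let rV_set0 : g_sigma_preimage rV_coord set0.
Proof. exact: sigma_algebra0. Qed.

Let rV_setC A : g_sigma_preimage rV_coord A -> g_sigma_preimage rV_coord (~` A).
Proof. exact: sigma_algebraC. Qed.

Let rV_bigcup (F : (set 'rV[R]_n)^nat) :
  (forall i, g_sigma_preimage rV_coord (F i)) ->
  g_sigma_preimage rV_coord (\bigcup_i F i).
Proof. exact: sigma_algebra_bigcup. Qed.

HB.instance Definition _ := @isMeasurable.Build
  (measure_tuple_display default_measure_display)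
  'rV[R]_n (g_sigma_preimage rV_coord) rV_set0 rV_setC rV_bigcup.

End measurable_rV.

Section lebesgue_rV.
Context {R : realType}.

Definition rV_cons n (p : 'rV[R]_n * measurableTypeR R) : 'rV[R]_n.+1 :=
  row_mx (p.2%:M : 'rV[R]_1) p.1.

Lemma measurable_rV_coord n (i : 'I_n) :
  measurable_fun [set: 'rV[R]_n] (@rV_coord R n i).
Proof.
move=> _ Y mY; rewrite setTI; apply: sub_sigma_algebra => /=.
rewrite -bigcup_seq/=; exists i => /=; first by rewrite mem_index_enum.
by exists Y => //; rewrite setTI.
Qed.

Lemma measurable_rV_cons n : measurable_fun setT (@rV_cons n).
Proof.
have mc (i : 'I_n.+1) : measurable_fun setT (@rV_coord R n.+1 i \o @rV_cons n).
  have [j ji|j ji] := @splitP 1 n i.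
    rewrite [X in measurable_fun _ X](_ : _ = snd) //.
    apply/funext => p /=; rewrite /rV_coord /rV_cons.
    have -> : i = lshift n j by exact/val_inj.
    by rewrite (@row_mxEl _ 1 1 n) (ord1 j) mxE eqxx.
  rewrite [X in measurable_fun _ X](_ : _ = @rV_coord R n j \o fst).
    exact: measurableT_comp (@measurable_rV_coord n j) _.
  apply/funext => p /=; rewrite /rV_coord /rV_cons.
  have -> : i = rshift 1 j by exact/val_inj.
  by rewrite (@row_mxEr _ 1 1 n).
move=> _ A mA; rewrite setTI.
suff: preimage_set_system setT (@rV_cons n) (g_sigma_preimage (@rV_coord R n.+1))
      `<=` measurable by apply; exists A; rewrite ?setTI.
rewrite -g_sigma_preimage_comp.
apply: smallest_sub; first exact: sigma_algebra_measurable.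
rewrite -bigcup_seq => B [i _ [C mC <-]]; exact: mc.
Qed.

Section lebesgue_rV_step.
Context (n : nat) (mu : {measure set 'rV[R]_n -> \bar R}).

Definition lebesgue_rV_step : set 'rV[R]_n.+1 -> \bar R :=
  pushforward (mu \x @lebesgue_measure R)%E (@rV_cons n).

Let mcons A : measurable A -> measurable (@rV_cons n @^-1` A).
Proof. by move=> mA; rewrite -[X in measurable X]setTI; exact: measurable_rV_cons. Qed.

Let step0 : lebesgue_rV_step set0 = 0%E.
Proof. by rewrite /lebesgue_rV_step /pushforward preimage_set0 measure0. Qed.

Let step_ge0 A : (0 <= lebesgue_rV_step A)%E.
Proof. by rewrite /lebesgue_rV_step /pushforward measure_ge0. Qed.

Let step_sigma_additive : semi_sigma_additive lebesgue_rV_step.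
Proof.
move=> F mF tF mUF; rewrite /lebesgue_rV_step /pushforward preimage_bigcup.
apply: measure_semi_sigma_additive.
- by move=> k; exact: mcons.
- apply/trivIsetP => /= i j _ _ ij; rewrite -preimage_setI.
  by move/trivIsetP : tF => /(_ _ _ _ _ ij) ->//; rewrite preimage_set0.
- by rewrite -preimage_bigcup; exact: mcons.
Qed.

HB.instance Definition _ := isMeasure.Build _ _ _
  lebesgue_rV_step step0 step_ge0 step_sigma_additive.

End lebesgue_rV_step.

(* n-fold product of the Lebesgue measure of R, transported to 'rV[R]_n *)
Fixpoint lebesgue_rV (n : nat) : {measure set 'rV[R]_n -> \bar R} :=
  match n with
  | 0 => \d_(0 : 'rV[R]_0)
  | k.+1 => lebesgue_rV_step (lebesgue_rV k)
  end.

Lemma lebesgue_rV_box n (a b : 'rV[R]_n) :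
  (forall i, a ord0 i <= b ord0 i) ->
  lebesgue_rV n [set x | forall i, a ord0 i <= x ord0 i <= b ord0 i] =
  (\prod_(i < n) (b ord0 i - a ord0 i))%:E.
Proof.
elim: n a b => [|n IH] a b ab.
  by rewrite big_ord0 /= diracE mem_set //= => -[].
pose tl (c : 'rV[R]_n.+1) : 'rV[R]_n := \row_i c ord0 (lift ord0 i).
have tlE (c : 'rV[R]_n.+1) i : tl c ord0 i = c ord0 (lift ord0 i) by rewrite mxE.
have cons0 (p : 'rV[R]_n * measurableTypeR R) : rV_cons p ord0 ord0 = p.2.
  have -> : (ord0 : 'I_n.+1) = lshift n (ord0 : 'I_1) by exact/val_inj.
  by rewrite /rV_cons (@row_mxEl _ 1 1 n) mxE eqxx.
have consS (p : 'rV[R]_n * measurableTypeR R) i :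
    rV_cons p ord0 (lift ord0 i) = p.1 ord0 i.
  have -> : lift ord0 i = rshift 1 i :> 'I_n.+1 by exact/val_inj.
  by rewrite /rV_cons (@row_mxEr _ 1 1 n).
rewrite /= /lebesgue_rV_step /pushforward.
have -> : @rV_cons n @^-1`
      [set x | forall i, a ord0 i <= x ord0 i <= b ord0 i] =
    [set x : 'rV[R]_n | forall i, tl a ord0 i <= x ord0 i <= tl b ord0 i] `*`
    (`[a ord0 ord0, b ord0 ord0] : set (measurableTypeR R)).
  apply/seteqP; split => [p /= H|p /= [H1 H2] i].
    split => [i|]; first by have := H (lift ord0 i); rewrite consS !tlE.
    by have := H ord0; rewrite cons0 in_itv.
  case: (unliftP ord0 i) => [j ->|->].
    by rewrite consS; have := H1 j; rewrite !tlE.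
  by rewrite cons0; move: H2; rewrite in_itv.
rewrite product_measure1E//; last first.
  rewrite (_ : mkset _ = \bigcap_(i in [set: 'I_n])
    ((@rV_coord R n i) @^-1` `[tl a ord0 i, tl b ord0 i])).
    apply: fin_bigcap_measurable => // i _.
    rewrite -[X in measurable X]setTI.
    by apply: measurable_rV_coord => //; exact: measurable_itv.
  apply/seteqP; split => x /= H i.
    by move=> _; rewrite /= in_itv; exact: H.
  by have := H i Logic.I; rewrite /= in_itv.
rewrite IH; last by move=> i; rewrite !tlE.
rewrite big_ord_recl mulrC EFinM; congr (_ * _)%E.
  by congr (_%:E); apply: eq_bigr => i _; rewrite !tlE.
apply: etrans (lebesgue_measure_itv _) _; rewrite /= lte_fin; case: ltP => // ba.
have -> : b ord0 ord0 = a ord0 ord0 by apply/eqP; rewrite eq_le ba ab.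
by rewrite subrr.
Qed.

End lebesgue_rV.

(* Points of space-time are pairs (x, t) with x : 'rV[R]_n and t : R. Functions
   on a subset A of R^n or of space-time are total functions of which only the
   values on A are used. *)
Section function_spaces.
Context {R : realType}.

(* C^infinity: all iterated directional derivatives are Frechet differentiable *)
Definition smooth (V : normedModType R) (f : V -> R) :=
  forall (vs : seq V) (x : V),
    differentiable (foldr (fun v (h : V -> R) => 'D_v h) f vs) x.

Definition supp (V : normedModType R) (f : V -> R) : set V :=
  closure [set x | f x != 0].

(* C_0^infinity(A), for A open *)
Definition test_function (V : normedModType R) (A : set V) (f : V -> R) :=
  [/\ smooth f, compact (supp f) & supp f `<=` A].

Definition compactly_inside (V : topologicalType) (A B : set V) :=
  compact (closure A) /\ closure A `<=` B.

Definition square_integrable d (S : measurableType d)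
    (mu : {measure set S -> \bar R}) (A : set S) (f : S -> \bar R) :=
  measurable_fun A f /\ (\int[mu]_(x in A) (f x ^+ 2) < +oo)%E.

Context {n : nat}.

Definition spacetime_measure :
    {measure set ('rV[R]_n * measurableTypeR R) -> \bar R} :=
  (@lebesgue_rV R n \x @lebesgue_measure R)%E.

(* f is in H^1(V) with weak gradient g *)
Definition H1 (V : set 'rV[R]_n) (f : 'rV[R]_n -> \bar R)
    (g : 'rV[R]_n -> 'rV[R]_n) :=
  [/\ square_integrable (@lebesgue_rV R n) V f,
      forall i, square_integrable (@lebesgue_rV R n) V
                  (fun x => (g x ord0 i)%:E) &
      forall (i : 'I_n) (phi : 'rV[R]_n -> R), test_function V phi ->
        (\int[@lebesgue_rV R n]_(x in V)
           (f x * ('D_(delta_mx ord0 i) phi x)%:E) =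
         - \int[@lebesgue_rV R n]_(x in V) (g x ord0 i * phi x)%:E)%E].

(* f is in L^2(s1, s2; H^1(V)) with weak spatial gradient g *)
Definition L2H1 (V : set 'rV[R]_n) (s1 s2 : R)
    (f : 'rV[R]_n * R -> \bar R) (g : 'rV[R]_n * R -> 'rV[R]_n) :=
  [/\ square_integrable spacetime_measure (V `*` `]s1, s2[) f,
      forall i, square_integrable spacetime_measure (V `*` `]s1, s2[)
                  (fun z => (g z ord0 i)%:E) &
      {ae @lebesgue_measure R, forall t, t \in `]s1, s2[ ->
        H1 V (fun x => f (x, t)) (fun x => g (x, t))}].

(* f is in L^2_loc(t1, t2; H^1_loc(U)) with weak spatial gradient g *)
Definition L2loc_H1loc (U : set 'rV[R]_n) (t1 t2 : R)
    (f : 'rV[R]_n * R -> \bar R) (g : 'rV[R]_n * R -> 'rV[R]_n) :=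
  forall (V : set 'rV[R]_n) (s1 s2 : R),
    open V -> compactly_inside V U -> t1 < s1 -> s1 < s2 -> s2 < t2 ->
    L2H1 V s1 s2 f g.

End function_spaces.

Section porous_medium.
Context {R : realType} {n : nat} (m : R).

Definition cylinder (U : set 'rV[R]_n) (t1 t2 : R) : set ('rV[R]_n * R) :=
  U `*` `]t1, t2[.

Definition parabolic_boundary (U : set 'rV[R]_n) (t1 t2 : R) :
    set ('rV[R]_n * R) :=
  ((closure U `\` interior U) `*` `]t1, t2[) `|` (closure U `*` [set t1]).

(* \iint_{U_{t1,t2}} (- w \partial_t phi + g . \nabla phi) dx dt, to be used
   with g the spatial gradient of w^m *)
Definition weak_form (U : set 'rV[R]_n) (t1 t2 : R)
    (w : 'rV[R]_n * R -> \bar R) (g : 'rV[R]_n * R -> 'rV[R]_n)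
    (phi : 'rV[R]_n * R -> R) : \bar R :=
  (\int[spacetime_measure]_(z in cylinder U t1 t2)
     (- (w z * ('D_((0, 1) : 'rV[R]_n * R) phi z)%:E) +
      (\sum_(i < n) g z ord0 i *
         'D_((delta_mx ord0 i, 0) : 'rV[R]_n * R) phi z)%:E))%E.

Definition weak_supersolution (U : set 'rV[R]_n) (t1 t2 : R)
    (w : 'rV[R]_n * R -> \bar R) :=
  (forall z, cylinder U t1 t2 z -> (0 <= w z)%E) /\
  exists2 g : 'rV[R]_n * R -> 'rV[R]_n,
    L2loc_H1loc U t1 t2 (fun z => poweR (w z) m) g &
    forall phi : 'rV[R]_n * R -> R,
      test_function (cylinder U t1 t2) phi -> (forall z, 0 <= phi z) ->
      (0 <= weak_form U t1 t2 w g phi)%E.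

Definition weak_subsolution (U : set 'rV[R]_n) (t1 t2 : R)
    (w : 'rV[R]_n * R -> \bar R) :=
  (forall z, cylinder U t1 t2 z -> (0 <= w z)%E) /\
  exists2 g : 'rV[R]_n * R -> 'rV[R]_n,
    L2loc_H1loc U t1 t2 (fun z => poweR (w z) m) g &
    forall phi : 'rV[R]_n * R -> R,
      test_function (cylinder U t1 t2) phi -> (forall z, 0 <= phi z) ->
      (weak_form U t1 t2 w g phi <= 0)%E.

Definition weak_solution (U : set 'rV[R]_n) (t1 t2 : R)
    (w : 'rV[R]_n * R -> \bar R) :=
  weak_supersolution U t1 t2 w /\ weak_subsolution U t1 t2 w.

Definition lower_semicontinuous_on (A : set ('rV[R]_n * R))
    (f : 'rV[R]_n * R -> \bar R) :=
  lower_semicontinuous (f : subspace A -> \bar R).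

Context (Omega : set 'rV[R]_n) (T : R).
Local Notation Omega_T := (cylinder Omega 0 T).

Definition supercaloric (u : 'rV[R]_n * R -> \bar R) :=
  [/\ forall z, Omega_T z -> (0 <= u z)%E,
      lower_semicontinuous_on Omega_T u,
      Omega_T `<=` closure [set z | Omega_T z /\ (u z < +oo)%E] &
      forall (U : set 'rV[R]_n) (t1 t2 : R) (w : 'rV[R]_n * R -> R),
        open U -> t1 < t2 -> closure (cylinder U t1 t2) `<=` Omega_T ->
        {within closure (cylinder U t1 t2), continuous w} ->
        weak_solution U t1 t2 (EFin \o w) ->
        (forall z, parabolic_boundary U t1 t2 z -> ((w z)%:E <= u z)%E) ->
        forall z, cylinder U t1 t2 z -> ((w z)%:E <= u z)%E].

Definition obstacle_solution (psi : 'rV[R]_n * R -> R)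
    (u : 'rV[R]_n * R -> \bar R) :=
  [/\ forall z, Omega_T z -> ((psi z)%:E <= u z)%E,
      supercaloric u &
      forall v : 'rV[R]_n * R -> \bar R, supercaloric v ->
        (forall z, Omega_T z -> ((psi z)%:E <= v z)%E) ->
        forall z, Omega_T z -> (u z <= v z)%E].

End porous_medium.

(* Main.v *)
Require Import Defs.
From HB Require Import structures.
From mathcomp Require Import all_boot all_order all_algebra.
From mathcomp Require Import all_classical all_reals all_analysis measurable_realfun.
From mathcomp Require Import ring lra.
Import Order.TTheory GRing.Theory Num.Theory.
Import numFieldNormedType.Exports.
Local Open Scope classical_set_scope.
Local Open Scope ring_scope.

Set Implicit Arguments.
Unset Strict Implicit.
Unset Printing Implicit Defensive.

(* The solution is the lower semicontinuous envelope of the infimum of all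
   supercaloric functions lying above psi: the comparison condition passes to
   the infimum, and then to the envelope because the competitor w is continuous
   in the open cylinder. Finiteness requires one competitor, a constant C >= psi;
   that constants are supercaloric is a maximum principle for continuous weak
   subsolutions w, with F = w^m.

   Suppose w exceeds its parabolic boundary values. Take an approximate maximum
   (y, t) of the space-time mean of F over a small neighbourhood of
   {y} x [t - h, t], minus d t with d > 0 small. Moving t back gives, at the scale
   of the mollification, F(y, t) >= F(y, t - h) + d up to small errors. Moving y
   shows that the Laplacian of the mean is nearly nonpositive, and then the weak
   formulation, tested with the mollifying kernel, gives w(y, t) <= w(y, t - h)
   up to small errors. These contradict each other, F being an increasing
   function of w. Approximate maxima suffice, with error u^3 when the shifts have
   size u, so that neither the mean nor its derivatives need be shown continuous. *)

(** The mean weights F by a spatial bump times a mollified indicator of [t - h, t], and the same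
    kernel is the test function. Its time derivative is a bump at t - h minus a bump at t, its
    Laplacian in x is that in y; so every derivative falls on an explicit kernel, and w is a mere
    bounded measurable weight until its continuity turns averages into values.

    The obstacle is that two different quantities get compared: the maximum bounds F(y, t) - F(y, t
    - h) below by about d, the equation bounds w(y, t) - w(y, t - h) above by a small error. They
    meet because s -> s^m is Lipschitz on [0, W], as m > 1.

    The order of choice is h, d, o, e, u. The scale h fits the room around a superlevel set of w; d
    keeps the total penalty below a fixed part of the gain, which is proportional to h; the
    oscillation o of w is small against d; e is the scale on which w oscillates by at most o; u
    comes last, since the error constants contain bounds on derivatives of the kernel, hence depend
    on e. All of them are uniform in (y, t), which is picked only after u. *)

(** * Explicit smooth functions *)

(* The derivatives of exp(-1/s), extended by 0 to s <= 0, are linear combinations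
   of these functions. *)
Definition exp_recip {R : realType} (k : nat) (s : R) : R :=
  if 0 < s then s ^- k * expR (- s^-1) else 0.

(* A class of differentiable functions closed under directional derivatives. *)
Inductive elem_smooth {R : realType} {V : normedModType R} : (V -> R) -> Prop :=
| ES_cst c : elem_smooth (fun=> c)
| ES_affine f : (forall x, differentiable f x) ->
    (forall v, exists c, forall x, 'D_v f x = c) -> elem_smooth f
| ES_add f g : elem_smooth f -> elem_smooth g -> elem_smooth (fun x => f x + g x)
| ES_mul f g : elem_smooth f -> elem_smooth g -> elem_smooth (fun x => f x * g x)
| ES_inv f : (forall x, f x != 0) -> elem_smooth f -> elem_smooth (fun x => (f x)^-1)
| ES_exp_recip k f : elem_smooth f -> elem_smooth (fun x => exp_recip k (f x)).

Section smooth_functions.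
Context {R : realType}.
Implicit Types (k : nat) (s : R).

Lemma exp_recip_ge0 k s : 0 <= exp_recip k s.
Proof.
rewrite /exp_recip; case: ifP => // s0.
by rewrite mulr_ge0 ?expR_ge0// invr_ge0 exprn_ge0// ltW.
Qed.

(** From e^x >= x^(k+2) / (k+2)! at x = 1/s. Taking two powers more than are divided out leaves s^2,
    a quadratic bound at 0. *)
Lemma exp_recip_le k s : exp_recip k s <= (k.+2)`!%:R * s ^+ 2.
Proof.
rewrite /exp_recip; case: ifPn => [s0|_]; last by rewrite mulr_ge0// sqr_ge0.
rewrite expRN -invfM.
have sk0 : 0 < s ^+ k by rewrite exprn_gt0.
have f0 : 0 < (k.+2)`!%:R :> R by rewrite ltr0n fact_gt0.
have := @expR_ge1Dxn R s^-1 k.+1; rewrite invr_ge0 (ltW s0) => /(_ isT).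
move=> H; have {}H : (s^-1 ^+ k.+2) / (k.+2)`!%:R <= expR s^-1.
  by apply: le_trans H; rewrite lerDr.
rewrite -[leLHS]mul1r ler_pdivrMr ?mulr_gt0 ?expR_gt0//.
move: H; rewrite exprVn -invfM -[leLHS]mul1r ler_pdivrMr; last first.
  by rewrite mulr_gt0// exprn_gt0.
by rewrite !exprS; lra.
Qed.

Lemma is_derive_quadratic (f : R -> R) (s l C : R) :
  (forall h, `|f (h + s) - f s - h * l| <= C * h ^+ 2) -> is_derive s 1 f l.
Proof.
move=> H; have C0 : 0 <= C.
  by have := H 1; rewrite expr1n mulr1; apply: le_trans.
have cv : (fun h => h^-1 *: (f (h *: 1 + s) - f s)) @ 0^' --> l.
  apply/cvgrPdist_lt => e e0; near=> h.
  have h0 : h != 0 by near: h; exact: nbhs_dnbhs_neq.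
  have hn0 : 0 < `|h| by rewrite normr_gt0.
  rewrite /GRing.scale /= mulr1.
  have -> : l - h^-1 * (f (h + s) - f s) = - (h^-1 * (f (h + s) - f s - h * l)).
    by field.
  rewrite normrN normrM normfV ltr_pdivrMl//.
  apply: le_lt_trans (H h) _.
  rewrite -real_normK ?num_real// expr2 mulrA (mulrC `|h| e) ltr_pM2r//.
  have : (C + 1) * `|h| < e.
    rewrite mulrC -ltr_pdivlMr; last by rewrite ltr_wpDl.
    by near: h; apply: dnbhs0_lt; rewrite divr_gt0// ltr_wpDl.
  by apply: le_lt_trans; rewrite ler_wpM2r// lerDl.
apply: DeriveDef; first by apply/cvg_ex; exists l.
exact/cvg_lim.
Unshelve. all: by end_near. Qed.

(** Away from 0 this is calculus; at 0 the bound [exp_recip_le] gives derivative 0. The derivative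
    stays within the family, which is what closes [elem_smooth] under differentiation. *)
Lemma is_derive_exp_recip k s :
  is_derive s 1 (exp_recip k) (exp_recip k.+2 s - k%:R * exp_recip k.+1 s).
Proof.
have [s0|s0|->] := ltgtP s 0.
- rewrite /exp_recip (le_gtF (ltW s0)) mulr0 subrr.
  apply: near_eq_is_derive (is_derive_cst 0 s 1).
  by near=> y; rewrite le_gtF// ltW//; near: y; exact: lt_nbhsl.
- have sn0 : s != 0 by rewrite gt_eqF.
  suff : is_derive s 1 (fun y : R => y ^- k * expR (- y^-1))
     (exp_recip k.+2 s - k%:R * exp_recip k.+1 s).
    apply: near_eq_is_derive.
    by near=> y; rewrite /exp_recip ifT//; near: y; exact: lt_nbhsr.
  have dV : is_derive s 1 (@GRing.inv R) (- (s^-1 ^+ 2)).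
    apply: DeriveDef; first by apply: (@derivableV _ _ id).
    by rewrite (@deriveV _ _ id)// derive_id /GRing.scale /= mulr1 exprVn.
  have dE : is_derive s 1 (expR \o (fun y : R => - y^-1)) (s^-1 ^+ 2 * expR (- s^-1)).
    have dN := @is_deriveN _ _ _ _ _ _ _ dV.
    have H := @is_derive1_comp _ _ _ _ _ _ (is_derive_expR ((- (@GRing.inv R)) s)) dN.
    apply: (is_derive_eq (f := expR \o (- (@GRing.inv R))%R) H).
    by rewrite opprK mulrC.
  have dX : is_derive s 1 ((@GRing.inv R) ^+ k) (- (k%:R * (s^-1) ^+ k.+1)).
    apply: is_derive_eq.
    case: k => [|k /=]; first by rewrite !mul0r scale0r oppr0.
    by rewrite /GRing.scale /= mulrN -mulrA -exprD addn2.
  have -> : (fun y : R => y ^- k * expR (- y^-1)) =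
    ((@GRing.inv R) ^+ k * (expR \o (fun y : R => - y^-1)))%R.
    by apply/funext => y; rewrite /= !fctE exprVn.
  apply: is_derive_eq.
  rewrite /exp_recip s0 /GRing.scale /= !fctE -!exprVn.
  by rewrite -[k.+2]addn2 exprD; ring.
- rewrite {2 3}/exp_recip ltxx mulr0 subrr.
  apply: (@is_derive_quadratic _ _ _ (k.+2)`!%:R) => h.
  rewrite mulr0 subr0 addr0 {2}/exp_recip ltxx subr0 ger0_norm ?exp_recip_ge0//.
  exact: exp_recip_le.
Unshelve. all: try by end_near.
Qed.

Lemma derive_comp_real {V : normedModType R} (g : R -> R) (f : V -> R) (x v : V) l :
  is_derive (f x) 1 g l -> differentiable f x ->
  'D_v (g \o f) x = l * 'D_v f x.
Proof.
move=> [dg gl] df; have dg' : differentiable g (f x) by exact/derivable1_diffP.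
rewrite deriveE; last exact: differentiable_comp.
rewrite diff_comp//= deriveE//.
by rewrite (deriv1E dg) derive1E gl /GRing.scale /= mulrC.
Qed.

Lemma elem_smooth_differentiable {V : normedModType R} (f : V -> R) :
  elem_smooth f -> forall x, differentiable f x.
Proof.
elim => {f} [c|f df _|f g _ df _ dg|f g _ df _ dg|f f0 _ df|k f _ df] x.
- exact: differentiable_cst.
- exact: df.
- exact: differentiableD.
- exact: differentiableM.
- exact: differentiableV.
- apply: (@differentiable_comp _ _ _ _ f (exp_recip k)) => //.
  by apply/derivable1_diffP; have [] := is_derive_exp_recip k (f x).
Qed.

Lemma eq_elem_smooth {V : normedModType R} (f g : V -> R) :
  elem_smooth f -> (forall x, f x = g x) -> elem_smooth g.
Proof. by move=> + fg; rewrite (_ : f = g)//; exact/funext. Qed.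

Lemma elem_smooth_derive {V : normedModType R} (f : V -> R) (v : V) :
  elem_smooth f -> elem_smooth (fun x => 'D_v f x).
Proof.
elim => {f} [c|f _ lf|f g sf sf' sg sg'|f g sf sf' sg sg'|f f0 sf sf'|k f sf sf'].
- by apply: (eq_elem_smooth (ES_cst 0)) => x; rewrite [RHS]derive_cst.
- by have [c fc] := lf v; apply: (eq_elem_smooth (ES_cst c)) => x; rewrite fc.
- apply: (eq_elem_smooth (ES_add sf' sg')) => x; apply/esym.
  by apply: deriveD; apply: diff_derivable; exact: elem_smooth_differentiable.
- apply: (eq_elem_smooth (ES_add (ES_mul sf sg') (ES_mul sg sf'))) => x; apply/esym.
  by apply: deriveM; apply: diff_derivable; exact: elem_smooth_differentiable.
- have sV := ES_inv f0 sf.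
  apply: (eq_elem_smooth (ES_mul (ES_mul (ES_cst (-1)) (ES_mul sV sV)) sf')) => x.
  rewrite deriveV//; last exact/diff_derivable/elem_smooth_differentiable.
  by rewrite /GRing.scale /= expr2 invfM mulN1r.
- apply: (eq_elem_smooth (ES_mul (ES_add (ES_exp_recip k.+2 sf)
    (ES_mul (ES_cst (- k%:R)) (ES_exp_recip k.+1 sf))) sf')) => x.
  rewrite mulNr; apply/esym; apply: (@derive_comp_real _ (exp_recip k) f).
    exact: is_derive_exp_recip.
  exact: elem_smooth_differentiable.
Qed.

Lemma elem_smooth_smooth {V : normedModType R} (f : V -> R) :
  elem_smooth f -> smooth f.
Proof.
move=> sf vs x; apply: elem_smooth_differentiable.
by elim: vs => //= v vs; exact: elem_smooth_derive.
Qed.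

(** Every constructor except [ES_affine] commutes with precomposition, so only that generator has to
    be examined for each [l]. *)
Lemma elem_smooth_comp {V W : normedModType R} (f : W -> R) (l : V -> W) :
  (forall g : W -> R, (forall x, differentiable g x) ->
    (forall v, exists c, forall x, 'D_v g x = c) -> elem_smooth (g \o l)) ->
  elem_smooth f -> elem_smooth (f \o l).
Proof.
move=> H; elim => {f} [c|f|f g _ sf _ sg|f g _ sf _ sg|f f0 _ sf|k f _ sf].
- exact: ES_cst.
- by move=> df lf; apply: H.
- exact: ES_add sf sg.
- exact: ES_mul sf sg.
- by apply: (ES_inv _ sf) => x; exact: f0.
- exact: ES_exp_recip sf.
Qed.

Lemma constant_derive_affine (g : R -> R) : (forall x, differentiable g x) ->
  (forall v, exists c, forall x, 'D_v g x = c) ->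
  exists a b, g = fun x => a * x + b.
Proof.
move=> dg /(_ 1) [a ga]; exists a, (g 0); apply/funext => x.
suff: g x - a * x = g 0 - a * 0 by lra.
apply: (@is_derive_0_is_cst _ (fun x => g x - a * x)) => y.
have dgy : is_derive y 1 g a.
  by apply: DeriveDef; [exact/derivable1_diffP|exact: ga].
have H := @is_deriveB _ _ _ _ _ _ _ _ _ dgy
  (@is_deriveZ _ _ _ _ a _ _ _ (is_derive_id y 1)).
by apply: is_derive_eq H _; rewrite /GRing.scale /= mulr1 subrr.
Qed.

Lemma elem_smooth_comp_real {V : normedModType R} (f : R -> R) (l : V -> R) :
  elem_smooth f -> elem_smooth l -> elem_smooth (f \o l).
Proof.
move=> sf sl; apply: elem_smooth_comp sf => g dg cg.
have [a [b ->]] := constant_derive_affine dg cg.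
by apply: ES_add (ES_cst _); exact: ES_mul (ES_cst _) sl.
Qed.

Lemma elem_smooth_prod {V : normedModType R} (I : Type) (r : seq I)
    (F : I -> V -> R) : (forall i, elem_smooth (F i)) ->
  elem_smooth (fun x => \prod_(i <- r) F i x).
Proof.
move=> sF; elim: r => [|i r IH].
  by apply: (eq_elem_smooth (ES_cst 1)) => x; rewrite big_nil.
by apply: (eq_elem_smooth (ES_mul (sF i) IH)) => x; rewrite big_cons.
Qed.

Lemma elem_smooth_id : elem_smooth (@id R).
Proof.
apply: ES_affine => [x|v]; first by apply/derivable1_diffP; exact: derivable_id.
by exists v => x; exact: derive_id.
Qed.

Lemma elem_smooth_continuous (f : R -> R) : elem_smooth f -> continuous f.
Proof.
by move=> sf x; exact/differentiable_continuous/elem_smooth_differentiable.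
Qed.

Lemma elem_smooth_is_derive (f : R -> R) (x : R) :
  elem_smooth f -> is_derive x 1 f ('D_1 f x).
Proof.
move=> sf; apply: DeriveDef => //.
exact/derivable1_diffP/elem_smooth_differentiable.
Qed.

(** A directional derivative sees only the restriction to a line; coordinates, projections and
    product kernels are thereby reduced to one variable. *)
Lemma derive_line {V : normedModType R} (f : V -> R) (a v : V) :
  'D_v f a = 'D_1 (fun h : R => f (h *: v + a)) 0.
Proof.
rewrite /derive; set F := (X in lim (X @ _)); set G := (X in _ = lim (X @ _)).
suff -> : F = G by [].
apply/funext => h; rewrite /F /G /= addr0 scale0r add0r.
by rewrite [h *: 1 in RHS]mulr1.
Qed.

Lemma derive_rV_coord n (i : 'I_n) (x v : 'rV[R]_n) :
  'D_v (fun y : 'rV[R]_n => y ord0 i) x = v ord0 i.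
Proof.
rewrite derive_line (_ : (fun _ => _) = (fun h => h * v ord0 i + x ord0 i)).
  have H : is_derive (0 : R) 1 (fun h => h * v ord0 i + x ord0 i) (v ord0 i).
    apply: (is_derive_quadratic (C := 0)) => h.
    by rewrite addr0 mul0r add0r mul0r normr_le0 addrK subrr.
  by have [] := H.
by apply/funext => h; rewrite !mxE.
Qed.

Lemma elem_smooth_fst {V W : normedModType R} (f : V -> R) : elem_smooth f ->
  elem_smooth (fun z : V * W => f z.1).
Proof.
apply: (@elem_smooth_comp _ _ _ fst) => g dg cg; apply: ES_affine => [x|v].
  apply: (@differentiable_comp _ _ _ _ fst g) => //.
  by apply: (@linear_differentiable _ _ _ fst) => y; exact: cvg_fst.
have [c gc] := cg v.1; exists c => x.
by rewrite derive_line /= -derive_line gc.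
Qed.

Lemma elem_smooth_snd {V W : normedModType R} (f : W -> R) : elem_smooth f ->
  elem_smooth (fun z : V * W => f z.2).
Proof.
apply: (@elem_smooth_comp _ _ _ snd) => g dg cg; apply: ES_affine => [x|v].
  apply: (@differentiable_comp _ _ _ _ snd g) => //.
  by apply: (@linear_differentiable _ _ _ snd) => y; exact: cvg_snd.
have [c gc] := cg v.2; exists c => x.
by rewrite derive_line /= -derive_line gc.
Qed.

Lemma elem_smooth_rV_coord n (i : 'I_n) (f : R -> R) : elem_smooth f ->
  elem_smooth (fun x : 'rV[R]_n => f (x ord0 i)).
Proof.
move=> sf; apply: (elem_smooth_comp_real sf).
apply: ES_affine => [x|v]; first exact: differentiable_coord.
by exists (v ord0 i) => x; rewrite derive_rV_coord.
Qed.

End smooth_functions.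

(** * Cutoff functions and finite differences *)

Section cutoff.
Context {R : realType}.
Implicit Types (s t e C : R) (f df : R -> R).

Lemma exp_recip_homo : {homo @exp_recip R 0 : s t / s <= t}.
Proof.
move=> s t st; rewrite {1}/exp_recip; case: ifPn => s0; last exact: exp_recip_ge0.
have t0 := lt_le_trans s0 st.
by rewrite /exp_recip t0 !expr0 !invr1 !mul1r ler_expR lerN2 lef_pV2.
Qed.

Lemma exp_recip_gt0 s : 0 < s -> 0 < exp_recip 0 s.
Proof. by move=> s0; rewrite /exp_recip s0 expr0 invr1 mul1r expR_gt0. Qed.

Lemma exp_recip_eq0 s : s <= 0 -> exp_recip 0 s = 0.
Proof. by move=> s0; rewrite /exp_recip ltNge s0. Qed.

(** The quotient a / (a + b), where a is nondecreasing and vanishes up to -e, and b is nonincreasing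
    and vanishes from e on. The denominator is positive because e + s and e - s cannot both be
    nonpositive. *)
Lemma smooth_step e : 0 < e -> exists A : R -> R,
  [/\ elem_smooth A, {homo A : s t / s <= t},
      forall s, s <= - e -> A s = 0 & forall s, e <= s -> A s = 1].
Proof.
move=> e0.
pose a s := exp_recip 0 (e + s); pose b s := exp_recip 0 (e - s).
have ab0 s : 0 < a s + b s.
  have [s0|s0] := leP 0 s.
    by rewrite ltr_wpDr ?exp_recip_ge0// exp_recip_gt0// ltr_wpDr.
  by rewrite ltr_wpDl ?exp_recip_ge0// exp_recip_gt0// subr_gt0 (lt_trans s0).
have sa : elem_smooth a.
  by apply: ES_exp_recip; exact: ES_add (ES_cst e) elem_smooth_id.
have sb : elem_smooth b.
  apply/ES_exp_recip/ES_add; first exact: (ES_cst e).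
  apply: eq_elem_smooth (ES_mul (ES_cst (-1)) elem_smooth_id) _ => s.
  by rewrite mulN1r.
exists (fun s => a s / (a s + b s)); split.
- apply: ES_mul => //; apply: ES_inv; last exact: ES_add.
  by move=> s; rewrite gt_eqF.
- move=> s t st; rewrite ler_pdivrMr// mulrAC ler_pdivlMr//.
  rewrite !mulrDr mulrC lerD2l mulrC [leRHS]mulrC.
  rewrite ler_pM ?exp_recip_ge0//.
    by apply: exp_recip_homo; rewrite lerD2l lerN2.
  by apply: exp_recip_homo; rewrite lerD2l.
- by move=> s se; rewrite /a exp_recip_eq0 ?mul0r//; lra.
- move=> s se; have -> : b s = 0 by apply: exp_recip_eq0; lra.
  rewrite addr0 divff// gt_eqF// exp_recip_gt0//; lra.
Qed.

Lemma derive_homo_ge0 f s : {homo f : s t / s <= t} -> derivable f s 1 ->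
  0 <= 'D_1 f s.
Proof.
move=> fi df; 
have cv : (fun h => h^-1 *: (f (h *: 1 + s) - f s)) @ 0^' --> 'D_1 f s by exact: df.
suff H : \forall h \near 0^', 0 <= h^-1 *: (f (h *: 1 + s) - f s).
  exact: (@closed_cvg _ _ _ _ _ (fun x : R => 0 <= x) (@closed_ge R 0) H _ cv).
near=> h; rewrite [h *: 1]mulr1 /GRing.scale /=.
have h0 : h != 0 by near: h; exact: nbhs_dnbhs_neq.
have [hp|hn] := ltP 0 h.
  apply: mulr_ge0; first by rewrite invr_ge0 ltW.
  by rewrite subr_ge0 fi// lerDr ltW.
apply: mulr_le0; first by rewrite invr_le0.
by rewrite subr_le0 fi// gerDr.
Unshelve. all: by end_near. Qed.

Lemma derive_eq0_outside f c e s : (forall t, e < `|t| -> f t = c) ->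
  e < `|s| -> 'D_1 f s = 0.
Proof.
move=> fc es; rewrite -(derive_cst c s 1); apply: near_eq_derive.
near=> t; rewrite /= fc//.
near: t; have H := @cvgr_norm_gt R R^o R (nbhs s) _ id s; apply: H es; exact: cvg_id.
Unshelve. all: by end_near. Qed.

Lemma elem_smooth_bounded f e : elem_smooth f ->
  (forall s, e < `|s| -> f s = 0) -> exists2 C, 0 <= C & forall s, `|f s| <= C.
Proof.
move=> sf f0.
have [e0|e0] := ltP e 0.
  by exists 0 => // s; rewrite f0 ?normr0// (lt_le_trans e0).
have cf : {within `[- e, e], continuous (fun s => `|f s|)}.
  apply: continuous_subspaceT => s; apply: continuous_comp.
    exact: elem_smooth_continuous.
  exact: norm_continuous.
have ee : - e <= e by lra.
have [c _ fc] := EVT_max ee cf.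
exists `|f c| => // s; have [es|es] := ltP e `|s|; first by rewrite f0// normr0.
by apply: fc; rewrite in_itv /= -ler_norml.
Qed.

Lemma lipschitz_derive f df C a b : a <= b ->
  (forall s, is_derive s 1 f (df s)) ->
  (forall s, s \in `[a, b] -> `|df s| <= C) -> `|f b - f a| <= C * (b - a).
Proof.
move=> ab dfs dC.
have [|c cab ->] := MVT_segment ab (fun s _ => dfs s).
  apply: continuous_subspaceT => s.
  by apply/differentiable_continuous/derivable1_diffP; have [] := dfs s.
by rewrite normrM (ger0_norm (_ : 0 <= b - a)) ?subr_ge0// ler_wpM2r ?subr_ge0// dC.
Qed.

Lemma is_derive_line f df s (c : R) : (forall u : R, is_derive u 1 f (df u)) ->
  is_derive s 1 (fun u => f (c + u)) (df (c + s)).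
Proof.
move=> fd; have H := is_deriveD (is_derive_cst c s 1) (is_derive_id s 1).
have := @is_derive1_comp _ _ _ _ _ _ (fd (c + s)) H.
by rewrite add0r mulr1.
Qed.

Lemma first_difference f C s t : elem_smooth f -> 0 <= t ->
  (forall u, `|'D_1 ('D_1 f) u| <= C) ->
  `|f (s + t) - f s - t * 'D_1 f s| <= C * t ^+ 2.
Proof.
move=> sf t0 fC.
have sf' := @elem_smooth_derive R R^o f 1 sf.
pose g (u : R) := f (s + u) - u * 'D_1 f s.
have dg (u : R) : is_derive u 1 g ('D_1 f (s + u) - 'D_1 f s).
  have H1 := is_derive_line u s (fun u => elem_smooth_is_derive u sf).
  have H2 := @is_deriveZ _ _ _ _ ('D_1 f s) _ _ _ (is_derive_id u 1).
  have H := is_deriveB H1 H2.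
  rewrite (_ : g = ((fun u : R => f (s + u)) - 'D_1 f s *: id)).
    by apply: is_derive_eq H _; rewrite /GRing.scale /= mulr1.
  by apply/funext => v; rewrite /g !fctE [_ *: _]mulrC.
have := lipschitz_derive t0 dg (C := C * t).
rewrite subr0 /g mul0r subr0 addr0 addrAC expr2 mulrA; apply => u.
rewrite in_itv /= => /andP[u0 ut].
have H1 v := is_derive_line v s (fun u => elem_smooth_is_derive u sf').
have := lipschitz_derive u0 H1 (C := C); rewrite addr0 subr0 => /(_ (fun v _ => fC _)).
move/le_trans; apply; rewrite ler_wpM2l//; exact: le_trans (fC 0).
Qed.

Let second_difference_arith (p q r c d u X : R) : 0 <= u ->
  `|p - q - u * c| <= X -> `|q - r - u * d| <= X -> u * `|c - d| <= X ->
  `|p - r - 2 * u * c| <= 3 * X.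
Proof.
move=> u0 H1 H2 H3; have {H3} : `|u * (c - d)| <= X by rewrite normrM (ger0_norm u0).
move: H1 H2; rewrite !ler_norml mulrBr.
have -> : 2 * u * c = 2 * (u * c) by ring.
move: (u * c) (u * d) => uc ud; lra.
Qed.

(** The derivative in t of the remainder is f'(s + t) - f'(s - t) - 2 t f''(s). It splits into two
    first-order remainders of f', based at s and at s - t, and the change of f'' between these
    points, each at most C t^2: hence the 3. The mean value inequality supplies the last factor
    t. *)
Lemma second_difference f C s t : elem_smooth f -> 0 <= t ->
  (forall u, `|'D_1 ('D_1 ('D_1 f)) u| <= C) ->
  `|f (s + t) + f (s - t) - 2 * f s - t ^+ 2 * 'D_1 ('D_1 f) s| <= 3 * C * t ^+ 3.
Proof.
move=> sf t0 fC.
have sf' := @elem_smooth_derive R R^o f 1 sf.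
have sf'' := @elem_smooth_derive R R^o _ 1 sf'.
have C0 : 0 <= C by exact: le_trans (fC 0).
have D (g : R -> R) (c u : R) : (forall u : R, is_derive u 1 g ('D_1 g u)) ->
   is_derive u 1 (fun u => g (c - u)) (- 'D_1 g (c - u)).
  move=> dg; have H := is_deriveB (is_derive_cst c u 1) (is_derive_id u 1).
  have := @is_derive1_comp _ g (cst c - id) u _ _ (dg (c - u)) H.
  by rewrite sub0r mulrN mulr1.
pose g (u : R) := f (s + u) + f (s - u) - u ^+ 2 * 'D_1 ('D_1 f) s.
pose g' u := 'D_1 f (s + u) - 'D_1 f (s - u) - 2 * u * 'D_1 ('D_1 f) s.
have dg (u : R) : is_derive u 1 g (g' u).
  have H1 := is_derive_line u s (fun u => elem_smooth_is_derive u sf).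
  have H2 := D f s u (fun u => elem_smooth_is_derive u sf).
  have H3 := @is_deriveZ _ _ _ _ ('D_1 ('D_1 f) s) _ _ _ (is_deriveX 2 (is_derive_id u 1)).
  have H := is_deriveB (is_deriveD H1 H2) H3.
  rewrite (_ : g = ((fun u : R => f (s + u)) + (fun u : R => f (s - u)) -
      'D_1 ('D_1 f) s *: id ^+ 2)).
    apply: is_derive_eq H _; rewrite /GRing.scale /= mulr1 /g' expr1; ring.
  by apply/funext => v; rewrite /g !fctE [_ *: _]mulrC.
have := lipschitz_derive t0 dg (C := 3 * C * t ^+ 2).
have -> : 3 * C * t ^+ 2 * (t - 0) = 3 * C * t ^+ 3.
  by rewrite subr0 -mulrA -exprSr.
have -> : g t - g 0 = f (s + t) + f (s - t) - 2 * f s - t ^+ 2 * 'D_1 ('D_1 f) s.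
  rewrite /g addr0 subr0 expr0n /= mul0r subr0 -mulr2n mulr_natl.
  by rewrite [LHS]addrAC.
apply => u; rewrite in_itv /= => /andP[u0 ut].
have Cut : C * u ^+ 2 <= C * t ^+ 2 by rewrite ler_wpM2l// ler_pXn2r// nnegrE.
have H1 := le_trans (first_difference s sf' u0 fC) Cut.
have := le_trans (first_difference (s - u) sf' u0 fC) Cut; rewrite subrK => H2.
rewrite /g' -[leRHS]mulrA; apply: (second_difference_arith u0 H1 H2).
apply: le_trans Cut; rewrite mulrC expr2 mulrA ler_wpM2r//.
have su : s - u <= s by rewrite gerBl.
have := lipschitz_derive su (fun v => elem_smooth_is_derive v sf'') (fun v _ => fC v).
by rewrite subKr.
Qed.

End cutoff.

(** * The Lebesgue measure of R^n *)

(* The Fubini theorems want a sigma-finite structure, which cannot be attached to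
   the application [lebesgue_rV n] itself. *)
Section sigma_finite_copy.
Context d (T : measurableType d) (R : realType) (mu : {measure set T -> \bar R}).

Definition sigma_finite_copy of sigma_finite setT mu : set T -> \bar R := mu.

HB.instance Definition _ s := Measure.copy (sigma_finite_copy s) mu.

HB.instance Definition _ s :=
  Measure_isSigmaFinite.Build d T R (sigma_finite_copy s) s.

Lemma sigma_finite_pack : sigma_finite setT mu ->
  exists nu : {sigma_finite_measure set T -> \bar R}, mu = nu.
Proof. by move=> s; exists (sigma_finite_copy s); exact: eq_measure. Qed.

End sigma_finite_copy.

Section lebesgue_rV_theory.
Context {R : realType}.
Local Notation leb := (@lebesgue_measure R).

Lemma measurable_closed_box n (a b : 'rV[R]_n) :
  measurable [set x : 'rV[R]_n | forall i, a ord0 i <= x ord0 i <= b ord0 i].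
Proof.
rewrite (_ : mkset _ = \bigcap_(i in [set: 'I_n])
    ((@rV_coord R n i) @^-1` `[a ord0 i, b ord0 i])).
  apply: fin_bigcap_measurable => // i _.
  rewrite -[X in measurable X]setTI.
  by apply: measurable_rV_coord => //; exact: measurable_itv.
apply/seteqP; split => x /= H i.
  by move=> _; rewrite /= in_itv; exact: H.
by have := H i Logic.I; rewrite /= in_itv.
Qed.

Lemma ball_rVE n (c x : 'rV[R]_n) (r : R) :
  ball c r x <-> (0 < r /\ forall i, `|c ord0 i - x ord0 i| < r).
Proof.
split => [[r0 H]|[r0 H]]; split => //.
  by move=> i; exact: H.
by move=> i j; rewrite (ord1 i); exact: H.
Qed.

Lemma measurable_ball_rV n (c : 'rV[R]_n) (r : R) : 0 < r -> measurable (ball c r).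
Proof.
move=> r0.
rewrite (_ : ball c r = \bigcap_(i in [set: 'I_n])
    ((@rV_coord R n i) @^-1` `]c ord0 i - r, c ord0 i + r[)).
  apply: fin_bigcap_measurable => // i _.
  rewrite -[X in measurable X]setTI.
  by apply: measurable_rV_coord => //; exact: measurable_itv.
apply/seteqP; split => x /=.
  move=> /ball_rVE [_ H] i _; rewrite /= in_itv /= -ltr_distl distrC.
  exact: H.
move=> H; apply/ball_rVE; split => // i.
by have := H i Logic.I; rewrite /= in_itv /= -ltr_distl distrC.
Qed.

Lemma lebesgue_rV_ball_lty n (c : 'rV[R]_n) (r : R) : 0 < r ->
  (lebesgue_rV n (ball c r) < +oo)%E.
Proof.
move=> r0; pose a := \row_i (c ord0 i - r); pose b := \row_i (c ord0 i + r).
apply: (@le_lt_trans _ _ (lebesgue_rV n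
    [set x | forall i, a ord0 i <= x ord0 i <= b ord0 i])).
  apply: le_measure; rewrite ?inE; [exact: measurable_ball_rV|exact: measurable_closed_box|].
  move=> x /ball_rVE [_ H] i; rewrite !mxE -ler_distl distrC.
  exact: ltW.
by rewrite lebesgue_rV_box ?ltry// => i; rewrite !mxE; lra.
Qed.

Lemma lebesgue_rV_sigma_finite n : sigma_finite setT (@lebesgue_rV R n).
Proof.
exists (fun k => ball 0 k.+1%:R).
  apply/esym/seteqP; split => // x _.
  have [k xk] : exists k : nat, `|x| < k.+1%:R.
    exists (Num.truncn `|x|); exact: truncnS_gt.
  exists k => //; rewrite -ball_normE /ball_ /= sub0r normrN//.
by move=> k; split; [exact: measurable_ball_rV|exact: lebesgue_rV_ball_lty].
Qed.

End lebesgue_rV_theory.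

(** * Tonelli and Fubini for kernels on R^n and on space-time *)

Section kernel_mass.
Context {R : realType}.
Local Notation leb := (@lebesgue_measure R).

Lemma measurable_rV_fun n (i : 'I_n) (f : R -> R) : measurable_fun setT f ->
  measurable_fun setT (fun x : 'rV[R]_n => f (x ord0 i)).
Proof.
move=> mf.
exact: (@measurableT_comp _ _ _ _ _ _ f _ (@rV_coord R n i) mf (measurable_rV_coord i)).
Qed.

Lemma measurable_rV_prod n (f : 'I_n -> R -> R) :
  (forall i, measurable_fun setT (f i)) ->
  measurable_fun setT (fun x : 'rV[R]_n => \prod_i f i (x ord0 i)).
Proof.
move=> mf; apply: (@measurable_prod _ 'rV[R]_n R setT _ _
  (fun i (x : 'rV[R]_n) => f i (x ord0 i))) => i _.
exact: measurable_rV_fun.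
Qed.

(** Induction on n: the measure of R^(n+1) is the push-forward of a product under [rV_cons], and
    Tonelli peels off the first coordinate. *)
Lemma integral_rV_prod n (f : 'I_n -> R -> R) :
  (forall i, measurable_fun setT (f i)) -> (forall i s, 0 <= f i s) ->
  (forall i, \int[leb]_s (f i s)%:E = 1)%E ->
  (\int[lebesgue_rV n]_x (\prod_i f i (x ord0 i))%:E = 1)%E.
Proof.
elim: n f => [|n IH] f mf f0 f1.
  rewrite (eq_integral (fun=> 1%E)); last by move=> x _; rewrite big_ord0.
  by rewrite integral_cst//= diracT mule1.
pose g (x : 'rV[R]_n) := \prod_(i < n) f (lift ord0 i) (x ord0 i).
have mg : measurable_fun setT g.
  exact: (@measurable_rV_prod n (fun i => f (lift ord0 i))).
have g0 x : 0 <= g x by apply: prodr_ge0.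
have g1 : (\int[lebesgue_rV n]_x (g x)%:E = 1)%E.
  by apply: (IH (fun i => f (lift ord0 i))) => // i; exact: f1.
have [nu nuE] := sigma_finite_pack (@lebesgue_rV_sigma_finite R n).
transitivity (\int[pushforward (lebesgue_rV n \x leb) (@rV_cons R n)]_x
  (\prod_(i < n.+1) f i (x ord0 i))%:E)%E; first by [].
rewrite ge0_integral_pushforward//; last 3 first.
- exact: measurable_rV_cons.
- by apply/measurable_EFinP; exact: (@measurable_rV_prod n.+1 f).
- by move=> x _; rewrite lee_fin prodr_ge0.
rewrite preimage_setT.
have E (p : 'rV[R]_n * measurableTypeR R) :
    \prod_(i < n.+1) f i (rV_cons p ord0 i) = f ord0 p.2 * g p.1.
  rewrite big_ord_recl; congr (f _ _ * _).
    have -> : (ord0 : 'I_n.+1) = lshift n (ord0 : 'I_1) by exact/val_inj.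
    by rewrite /rV_cons (@row_mxEl _ 1 1 n) mxE eqxx.
  apply: eq_bigr => i _; congr (f _ _).
  have -> : lift ord0 i = rshift 1 i :> 'I_n.+1 by exact/val_inj.
  by rewrite /rV_cons (@row_mxEr _ 1 1 n).
under eq_integral do rewrite /= E.
rewrite nuE fubini_tonelli2/=; last 2 first.
- apply/measurable_EFinP; apply: measurable_funM.
    exact: (measurableT_comp (mf ord0) measurable_snd).
  exact: (measurableT_comp mg measurable_fst).
- by move=> x; rewrite lee_fin mulr_ge0.
rewrite /fubini_G /=; under eq_integral => s _.
  under eq_integral do rewrite EFinM.
  rewrite ge0_integralZl//; last 3 first.
  - exact/measurable_EFinP.
  - by move=> x _; rewrite lee_fin.
  - by rewrite lee_fin.
  rewrite -nuE g1 mule1.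
  over.
exact: f1.
Qed.

Lemma derive_step_eq0 (A : R -> R) (e s : R) :
  (forall s, s <= - e -> A s = 0) -> (forall s, e <= s -> A s = 1) ->
  e < `|s| -> 'D_1 A s = 0.
Proof.
move=> A0 A1; rewrite ltr_normr => /orP[es|es].
  rewrite -(derive_cst (1 : R) s 1); apply: near_eq_derive.
  by near=> t; rewrite A1// ltW//; near: t; exact: lt_nbhsr.
rewrite -(derive_cst (0 : R) s 1); apply: near_eq_derive.
by near=> t; rewrite A0// ltW//; near: t; apply: lt_nbhsl; rewrite ltrNr.
Unshelve. all: by end_near. Qed.

Lemma integral_derive_step (A : R -> R) (e y : R) : 0 < e -> elem_smooth A ->
  (forall s, s <= - e -> A s = 0) -> (forall s, e <= s -> A s = 1) ->
  (\int[leb]_s ('D_1 A (s - y))%:E = 1)%E.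
Proof.
move=> e0 sA A0 A1.
have sA' := @elem_smooth_derive R R^o A 1 sA.
pose a := y - (e + 1); pose b := y + (e + 1).
pose B s := A (- y + s).
have dB (s : R) : is_derive s 1 B ('D_1 A (s - y)).
  rewrite addrC; apply: (@is_derive_line _ A ('D_1 A)) => u.
  exact: elem_smooth_is_derive.
have cB (s : R) : {for s, continuous B}.
  by apply/differentiable_continuous/derivable1_diffP; have [] := dB s.
transitivity (\int[leb]_(s in `[a, b]) ('D_1 A (s - y))%:E)%E.
  rewrite [RHS]integral_mkcond; apply: eq_integral => s _.
  rewrite patchE; case: ifPn => //; rewrite notin_setE /= in_itv /= => sab.
  rewrite (derive_step_eq0 A0 A1)// ltr_normr.
  apply: contrapT => /negP; rewrite negb_or -!leNgt => /andP[h1 h2]; apply: sab.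
  by rewrite /a /b; apply/andP; split; lra.
have ab : a < b by rewrite /a /b; lra.
rewrite (@continuous_FTC2 _ _ B a b ab).
- by rewrite /B A1 ?A0; [rewrite sube0| rewrite /a; lra| rewrite /b; lra].
- apply: continuous_subspaceT => s.
  apply: (@continuous_comp _ _ _ (fun s => s - y) ('D_1 A)).
    by apply: continuousB; [exact: cvg_id|exact: cvg_cst].
  exact: elem_smooth_continuous.
- split.
  + by move=> s _; have [] := dB s.
  + by apply: cvg_at_right_filter; exact: cB.
  + by apply: cvg_at_left_filter; exact: cB.
- by move=> s _; rewrite derive1E; have [] := dB s.
Qed.

Lemma integral_kernel n (J : 'rV[R]_n -> R) (k : R -> R) :
  measurable_fun setT J -> measurable_fun setT k ->
  (forall x, 0 <= J x) -> (forall s, 0 <= k s) ->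
  (\int[lebesgue_rV n]_x (J x)%:E = 1 ->
   \int[spacetime_measure]_z (J z.1 * k z.2)%:E = \int[leb]_s (k s)%:E)%E.
Proof.
move=> mJ mk J0 k0 J1.
have [nu nuE] := sigma_finite_pack (@lebesgue_rV_sigma_finite R n).
rewrite /spacetime_measure; move: J1; rewrite nuE => J1.
rewrite fubini_tonelli2/=; last 2 first.
- apply/measurable_EFinP; apply: measurable_funM.
    exact: (measurableT_comp mJ measurable_fst).
  exact: (measurableT_comp mk measurable_snd).
- by move=> x; rewrite lee_fin mulr_ge0.
rewrite /fubini_G /=; apply: eq_integral => s _.
under eq_integral do rewrite EFinM.
rewrite ge0_integralZr//; last 3 first.
- exact/measurable_EFinP.
- by move=> x _; rewrite lee_fin.
- by rewrite lee_fin.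
by rewrite J1 mul1e.
Qed.

(** Weak gradients are given on time slices, so space-time integrals are reached through iterated
    ones. Measurability of the inner integral is returned as well, since slices will be compared
    almost everywhere. *)
Lemma integral_slab n (V : set 'rV[R]_n) (I : set R) (f : 'rV[R]_n * R -> \bar R) :
  measurable V -> measurable I -> spacetime_measure.-integrable (V `*` I) f ->
  measurable_fun I (fun t : measurableTypeR R => \int[lebesgue_rV n]_(x in V) f (x, t))%E /\
  (\int[spacetime_measure]_(z in V `*` I) f z =
   \int[leb]_(t in I) \int[lebesgue_rV n]_(x in V) f (x, t))%E.
Proof.
move=> mV mI intf.
have [nu nuE] := sigma_finite_pack (@lebesgue_rV_sigma_finite R n).
have mVI : measurable (V `*` (I : set (measurableTypeR R))) by exact: measurableX.
have intg : (nu \x leb)%E.-integrable setT (f \_ (V `*` I)).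
  by move: intf; rewrite /spacetime_measure nuE => /(integrable_mkcond _ mVI).
have E : fubini_G nu (f \_ (V `*` I)) =
    (fun t => \int[lebesgue_rV n]_(x in V) f (x, t))%E \_ I.
  apply/funext => t; rewrite /fubini_G -nuE patchE; case: ifPn => tI.
    rewrite [RHS]integral_mkcond; apply: eq_integral => x _.
    rewrite !patchE; congr (if _ then _ else _).
    by rewrite in_setX tI andbT.
  apply: integral0_eq => x _; rewrite patchE ifF//.
  by rewrite in_setX (negbTE tI) andbF.
split.
  apply: (proj2 (measurable_restrictT _ mI)); rewrite -E.
  exact: (measurable_fubini_G intg).
rewrite integral_mkcond [RHS]integral_mkcond -E.
by rewrite -[LHS]/(integral (lebesgue_rV n \x leb)%E _ _) nuE integral21_prod_meas1.
Qed.

End kernel_mass.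

(** * Product kernels *)

(** Partial derivatives of a product kernel are again product kernels, so that one set of lemmas on
    support, bounds and measurability covers the kernel and all its derivatives. *)
Definition derive_factor {R : realType} n (a : 'I_n -> R -> R) (i j : 'I_n) : R -> R :=
  if j == i then 'D_1 (a j) else a j.

Definition prod_kernel {R : realType} n (a : 'I_n -> R -> R) (x : 'rV[R]_n) : R :=
  \prod_j a j (x ord0 j).

Section product_kernels.
Context {R : realType} {n : nat}.
Implicit Types (a : 'I_n -> R -> R) (c x : 'rV[R]_n) (e : R).

Lemma derive_eq0_near_zero (f : R -> R) (c e : R) :
  (forall s, e < `|s - c| -> f s = 0) -> forall s, e < `|s - c| -> 'D_1 f s = 0.
Proof.
move=> f0 s es; rewrite -(derive_cst (0 : R) s 1); apply: near_eq_derive.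
near=> t; rewrite /= f0//.
near: t; have H := @cvgr_norm_gt R R^o R (nbhs s) _ (fun t => t - c) (s - c).
by apply: H es; apply: cvgB; [exact: cvg_id|exact: cvg_cst].
Unshelve. all: by end_near. Qed.

Lemma derive_line_factor {V : normedModType R} (f : V -> R) (b v : V) (g : R -> R) (c s : R) :
  elem_smooth g -> (forall h : R, f (h *: v + b) = c * g (h + s)) ->
  'D_v f b = c * 'D_1 g s.
Proof.
move=> sg fg; rewrite derive_line.
have -> : (fun h : R => f (h *: v + b)) = c \*o (fun h => g (h *: 1 + s)).
  by apply/funext => h; rewrite fg /= [h *: 1]mulr1.
rewrite deriveMl -?derive_line//.
have sg' : elem_smooth (fun h : R => g (h *: 1 + s)).
  apply: (elem_smooth_comp_real sg); apply: ES_add (ES_cst _).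
  by apply: (eq_elem_smooth elem_smooth_id) => h; rewrite [RHS]mulr1.
exact/derivable1_diffP/elem_smooth_differentiable.
Qed.

Lemma elem_smooth_prod_kernel a : (forall i, elem_smooth (a i)) ->
  elem_smooth (prod_kernel a).
Proof.
move=> sa; apply: (@elem_smooth_prod R 'rV[R]_n _ _ (fun i x => a i (x ord0 i))) => i.
exact: elem_smooth_rV_coord.
Qed.

Lemma elem_smooth_derive_factor a i : (forall j, elem_smooth (a j)) ->
  forall j, elem_smooth (derive_factor a i j).
Proof.
move=> sa j; rewrite /derive_factor; case: ifP => // _.
exact: (@elem_smooth_derive R R^o _ 1).
Qed.

Lemma derive_factor_eq0 a i c e :
  (forall j s, e < `|s - c ord0 j| -> a j s = 0) ->
  forall j s, e < `|s - c ord0 j| -> derive_factor a i j s = 0.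
Proof.
move=> a0 j; rewrite /derive_factor; case: ifP => _; last exact: a0.
exact: (derive_eq0_near_zero (a0 j)).
Qed.

Lemma prod_kernel_shift a i x h :
  prod_kernel a (h *: delta_mx ord0 i + x) =
  (\prod_(j | j != i) a j (x ord0 j)) * a i (h + x ord0 i).
Proof.
rewrite /prod_kernel (bigD1 i)//= mulrC; congr (_ * a i _).
  apply: eq_bigr => j ji; rewrite !mxE eqxx /= (negbTE ji).
  by rewrite mulr0 add0r.
by rewrite !mxE !eqxx mulr1.
Qed.

Lemma derive_prod_kernel a i x : (forall j, elem_smooth (a j)) ->
  'D_(delta_mx ord0 i) (prod_kernel a) x = prod_kernel (derive_factor a i) x.
Proof.
move=> sa; rewrite (derive_line_factor (sa i) (fun h => prod_kernel_shift a i x h)).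
rewrite /prod_kernel [RHS](bigD1 i)//= mulrC; congr (_ * _).
  by rewrite /derive_factor eqxx.
by apply: eq_bigr => j ji; rewrite /derive_factor (negbTE ji).
Qed.

Lemma derive_space_kernel a i (k : R -> R) (z : 'rV[R]_n * R) :
  (forall j, elem_smooth (a j)) ->
  'D_((delta_mx ord0 i, 0) : 'rV[R]_n * R) (fun z => prod_kernel a z.1 * k z.2) z =
  prod_kernel (derive_factor a i) z.1 * k z.2.
Proof.
move=> sa; pose c := (\prod_(j | j != i) a j (z.1 ord0 j)) * k z.2.
rewrite (@derive_line_factor _ _ _ _ (a i) c (z.1 ord0 i))//.
  rewrite /c mulrAC; congr (_ * _).
  rewrite /prod_kernel [RHS](bigD1 i)//= mulrC; congr (_ * _).
    by rewrite /derive_factor eqxx.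
  by apply: eq_bigr => j ji; rewrite /derive_factor (negbTE ji).
by move=> h; rewrite /= prod_kernel_shift scaler0 add0r mulrAC.
Qed.

Lemma derive_time_kernel a (k : R -> R) (z : 'rV[R]_n * R) : elem_smooth k ->
  'D_((0, 1) : 'rV[R]_n * R) (fun z => prod_kernel a z.1 * k z.2) z =
  prod_kernel a z.1 * 'D_1 k z.2.
Proof.
move=> sk; apply: derive_line_factor => // h /=.
by rewrite scaler0 add0r [h *: 1]mulr1.
Qed.

Lemma prod_kernel_bounded a c e :
  (forall j, elem_smooth (a j)) ->
  (forall j s, e < `|s - c ord0 j| -> a j s = 0) ->
  exists2 C, 0 <= C & forall x, `|prod_kernel a x| <= C.
Proof.
move=> sa a0.
have /choice [C HC] : forall i, exists C, 0 <= C /\ forall s, `|a i s| <= C.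
  move=> i; have [|C C0 HC] := @elem_smooth_bounded _ (a i) (e + `|c ord0 i|) (sa i).
    move=> s es; apply: a0; have := ler_normD (s - c ord0 i) (c ord0 i).
    by rewrite subrK; lra.
  by exists C.
exists (\prod_i C i); first by apply: prodr_ge0 => i _; have [] := HC i.
move=> x; rewrite /prod_kernel normr_prod; apply: ler_prod => i _.
by rewrite normr_ge0 /=; have [] := HC i.
Qed.

Lemma measurable_elem_smooth (f : R -> R) : elem_smooth f -> measurable_fun setT f.
Proof.
by move=> sf; apply: continuous_measurable_fun; exact: elem_smooth_continuous.
Qed.

Lemma measurable_prod_kernel a : (forall i, elem_smooth (a i)) ->
  measurable_fun setT (prod_kernel a).
Proof. by move=> sa; apply: measurable_rV_prod => i; exact: measurable_elem_smooth. Qed.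

End product_kernels.

(** * Product kernels as test functions *)

Section test_kernels.
Context {R : realType} {n : nat}.
Implicit Types (a : 'I_n -> R -> R) (c x : 'rV[R]_n) (e : R).

Definition closed_box c e : set 'rV[R]_n :=
  [set x | forall j, `|x ord0 j - c ord0 j| <= e].

Lemma compact_closed_box c e : compact (closed_box c e).
Proof.
rewrite (_ : closed_box c e = [set x : 'rV[R]_n |
    forall j, `[c ord0 j - e, c ord0 j + e]%classic (x ord0 j)]).
  apply: (@rV_compact R n (fun j => `[c ord0 j - e, c ord0 j + e]%classic)) => j.
  exact: segment_compact.
by apply/seteqP; split => x H j; have := H j; rewrite /= in_itv /= ler_distl.
Qed.

Lemma test_function_compact (V : normedModType R) (K A : set V) (f : V -> R) :
  elem_smooth f -> compact K -> K `<=` A -> (forall z, ~ K z -> f z = 0) ->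
  test_function A f.
Proof.
move=> sf cK KA f0.
have sK : supp f `<=` K.
  rewrite (proj1 (closure_id K) (compact_closed (@norm_hausdorff _ V) cK)).
  apply: closureS => z /= fz; apply: contrapT => /f0 fz0.
  by rewrite fz0 eqxx in fz.
split; first exact: elem_smooth_smooth.
  by apply: (subclosed_compact _ cK sK); exact: closed_closure.
exact: subset_trans sK KA.
Qed.

Lemma box_sub_ball c e r : 0 < r -> e < r ->
  closed_box c e `<=` ball c r.
Proof.
move=> r0 er x H; apply/ball_rVE; split => // i.
by rewrite distrC; exact: le_lt_trans (H i) er.
Qed.

Lemma prod_kernel_outside a c e x : (forall j s, e < `|s - c ord0 j| -> a j s = 0) ->
  ~ closed_box c e x ->
  prod_kernel a x = 0.
Proof.
move=> a0 nx.
have [j /negP] : exists j, ~ (`|x ord0 j - c ord0 j| <= e).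
  exact/existsNP.
by rewrite -ltNge => xj; rewrite /prod_kernel (bigD1 j)//= a0 ?mul0r.
Qed.

Lemma test_function_space a c e r (k : R) : 0 < r -> e < r ->
  (forall j, elem_smooth (a j)) ->
  (forall j s, e < `|s - c ord0 j| -> a j s = 0) ->
  test_function (ball c r) (fun x => prod_kernel a x * k).
Proof.
move=> r0 er sa a0.
apply: (@test_function_compact 'rV[R]_n (closed_box c e)).
- by apply: ES_mul (ES_cst k); exact: elem_smooth_prod_kernel.
- exact: compact_closed_box.
- exact: box_sub_ball.
- by move=> x nx; rewrite (prod_kernel_outside a0 nx) mul0r.
Qed.

Lemma test_function_spacetime a c e (k : R -> R) (s1 s2 : R) (A : set ('rV[R]_n * R)) :
  (forall j, elem_smooth (a j)) -> elem_smooth k ->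
  (forall j s, e < `|s - c ord0 j| -> a j s = 0) ->
  (forall s, s < s1 \/ s2 < s -> k s = 0) ->
  closed_box c e `*` `[s1, s2]
    `<=` A ->
  test_function A (fun z => prod_kernel a z.1 * k z.2).
Proof.
move=> sa sk a0 k0 KA.
apply: (@test_function_compact ('rV[R]_n * R)%type (closed_box c e `*` `[s1, s2])) => //.
- apply: ES_mul; last exact: (elem_smooth_snd (V := 'rV[R]_n) sk).
  exact: (elem_smooth_fst (W := R) (elem_smooth_prod_kernel sa)).
- by apply: compact_setX; [exact: compact_closed_box|exact: segment_compact].
- move=> z nz.
  have [xz|nxz] := pselect (closed_box c e z.1); last first.
    by rewrite (prod_kernel_outside a0 nxz) mul0r.
  rewrite k0 ?mulr0//; have [h|h] := ltP z.2 s1; first by left.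
  have [h'|h'] := ltP s2 z.2; first by right.
  by exfalso; apply: nz; split => //=; rewrite in_itv /= h h'.
Qed.

End test_kernels.

(** * Integrability on a ball times a time interval *)

Section slabs.
Context {R : realType} {n : nat}.
Implicit Types (c : 'rV[R]_n).
Local Notation leb := (@lebesgue_measure R).
Local Notation mu := (@spacetime_measure R n).

Definition slab c (r s1 s2 : R) : set ('rV[R]_n * measurableTypeR R) :=
  ball c r `*` `]s1, s2[.

Lemma measurable_slab c r s1 s2 : 0 < r -> measurable (slab c r s1 s2).
Proof.
move=> r0; apply: measurableX; first exact: measurable_ball_rV.
exact: measurable_itv.
Qed.

Lemma slab_lty c r s1 s2 : 0 < r -> (mu (slab c r s1 s2) < +oo)%E.
Proof.
move=> r0; have mI : measurable (`]s1, s2[%classic : set (measurableTypeR R)).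
  exact: measurable_itv.
rewrite /slab /spacetime_measure /= product_measure1E//; last exact: measurable_ball_rV.
have Iy : (leb `]s1, s2[ < +oo)%E.
  by rewrite lebesgue_measure_itv/=; case: ifP => // _; exact: ltry.
apply: lte_mul_pinfty; [exact: measure_ge0| |exact: Iy].
by rewrite ge0_fin_numE//; exact: lebesgue_rV_ball_lty.
Qed.

Lemma bounded_integrable d (T : measurableType d) (nu : {measure set T -> \bar R})
    (A : set T) (f : T -> R) (C : R) : measurable A -> (nu A < +oo)%E ->
  measurable_fun A f -> (forall x, A x -> `|f x| <= C) ->
  nu.-integrable A (EFin \o f).
Proof.
move=> mA Afin mf fC; apply: measurable_bounded_integrable => //.
exists C; split; first exact: num_real.
by move=> M CM x Ax; apply: le_trans (fC x Ax) (ltW CM).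
Qed.

(** By |g| <= 1 + g^2, constants being integrable on a set of finite measure. *)
Lemma square_integrable_integrable d (T : measurableType d)
    (nu : {measure set T -> \bar R}) (A : set T) (g : T -> R) : measurable A ->
  (nu A < +oo)%E -> square_integrable nu A (EFin \o g) -> nu.-integrable A (EFin \o g).
Proof.
move=> mA Afin [mg g2].
have mg' : measurable_fun A g by exact/measurable_EFinP.
have i2 : nu.-integrable A (EFin \o (fun x => g x ^+ 2)).
  apply/integrableP; split; first by apply/measurable_EFinP; exact: measurable_funX.
  rewrite (eq_integral (fun x => ((g x)%:E ^+ 2)%E))// => x _ /=.
  by rewrite ger0_norm ?sqr_ge0// EFin_expe.
have i1 : nu.-integrable A (EFin \o (fun=> 1)).
  by apply: (@bounded_integrable _ _ _ _ _ 1) => // x _; rewrite normr1.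
apply: (le_integrable mA mg _ (integrableD mA i1 i2)) => x _ /=.
rewrite lee_fin [leRHS]ger0_norm ?addr_ge0 ?sqr_ge0//.
have := sqr_ge0 (`|g x| - 1); rewrite -(real_normK (num_real (g x))).
nra.
Qed.

End slabs.

(** * Testing the weak formulation with product kernels *)

Section integration_by_parts.
Context {R : realType} {n : nat}.
Local Notation leb := (@lebesgue_measure R).
Local Notation mu := (@spacetime_measure R n).
Variables (c : 'rV[R]_n) (r e s1 s2 : R).
Hypotheses (r0 : 0 < r) (er : e < r).
Local Notation V := (ball c r).
Local Notation D := (slab c r s1 s2).

Lemma measurable_kernel (a : 'I_n -> R -> R) (k : R -> R) :
  (forall j, elem_smooth (a j)) -> elem_smooth k ->
  measurable_fun [set: 'rV[R]_n * measurableTypeR R] (fun z => prod_kernel a z.1 * k z.2).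
Proof.
move=> sa sk; apply: measurable_funM.
  exact: (measurableT_comp (measurable_prod_kernel sa) measurable_fst).
exact: (measurableT_comp (measurable_elem_smooth sk) measurable_snd).
Qed.

Lemma integrable_kernelM (g K : 'rV[R]_n * measurableTypeR R -> R) (C : R) :
  mu.-integrable D (EFin \o g) -> measurable_fun setT K ->
  (forall z, `|K z| <= C) -> mu.-integrable D (EFin \o (fun z => g z * K z)).
Proof.
move=> ig mK KC.
have mD := measurable_slab c s1 s2 r0.
have H := @integrableMl _ _ _ mu D mD (EFin \o g) K ig.
apply: eq_integrable (H _ _) => //.
  exact: measurable_funTS.
exists C; split; first exact: num_real.
by move=> M CM x _; exact: le_trans (KC x) (ltW CM).
Qed.

(** On almost every time slice k(t) is a number and [prod_kernel a] times this number is a test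
    function on the ball, so the weak gradient can be tested with it; Fubini assembles the
    slices. *)
Lemma integral_by_parts (F : 'rV[R]_n * R -> R) (g : 'rV[R]_n * R -> 'rV[R]_n)
    (a : 'I_n -> R -> R) (k : R -> R) (i : 'I_n) (CF Ck : R) :
  L2H1 V s1 s2 (EFin \o F) g -> (forall z, D z -> `|F z| <= CF) ->
  (forall j, elem_smooth (a j)) ->
  (forall j s, e < `|s - c ord0 j| -> a j s = 0) ->
  elem_smooth k -> (forall s, `|k s| <= Ck) ->
  (\int[mu]_(z in D) (g z ord0 i * (prod_kernel a z.1 * k z.2))%:E =
   - \int[mu]_(z in D) (F z * (prod_kernel (derive_factor a i) z.1 * k z.2))%:E)%E.
Proof.
move=> [[mF F2] gL gH] FC sa a0 sk kC.
have sa' := elem_smooth_derive_factor i sa.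
have a0' := derive_factor_eq0 i a0.
have [Ca Ca0 aC] := prod_kernel_bounded sa a0.
have [Ca' Ca'0 a'C] := prod_kernel_bounded sa' a0'.
have mD := measurable_slab c s1 s2 r0.
have Dy := slab_lty c s1 s2 r0.
have mV := @measurable_ball_rV R n c r r0.
have Vy := @lebesgue_rV_ball_lty R n c r r0.
have mI : measurable (`]s1, s2[%classic : set (measurableTypeR R)).
  exact: measurable_itv.
have ig : mu.-integrable D (EFin \o (fun z => g z ord0 i)).
  exact: square_integrable_integrable (gL i).
have iF : mu.-integrable D (EFin \o F).
  by apply: (@bounded_integrable _ _ _ _ _ _ CF) => //; exact/measurable_EFinP.
have i1 : mu.-integrable D (EFin \o (fun z => g z ord0 i * (prod_kernel a z.1 * k z.2))).
  apply: (integrable_kernelM (C := Ca * Ck) ig (measurable_kernel sa sk)) => z.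
  by rewrite normrM ler_pM.
have i2 : mu.-integrable D
    (EFin \o (fun z => F z * (prod_kernel (derive_factor a i) z.1 * k z.2))).
  apply: (integrable_kernelM (C := Ca' * Ck) iF (measurable_kernel sa' sk)) => z.
  by rewrite normrM ler_pM.
have [m1 ->] := integral_slab mV mI i1.
rewrite -integralN; last exact: integrable_add_def.
have i3 : mu.-integrable D
  (fun z => - (F z * (prod_kernel (derive_factor a i) z.1 * k z.2))%:E)%E.
  exact: integrableN.
have [m2 ->] := integral_slab mV mI i3.
apply: ae_eq_integral => //.
case: gH => N [mN N0 sN]; exists N; split => // t nt; apply: sN => tH.
apply: nt => /= tI.
have {}tI : t \in `]s1, s2[ by [].
have [[mFt _] _ /(_ i (fun x => prod_kernel a x * k t)) HH] := tH tI.
have {}HH := HH (test_function_space (k t) r0 er sa a0).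
have i4 : (lebesgue_rV n).-integrable V
    (EFin \o (fun x => F (x, t) * (prod_kernel (derive_factor a i) x * k t))).
  apply: (@bounded_integrable _ _ _ _ _ _ (CF * (Ca' * Ck))) => //.
    apply: measurable_funM; first exact/measurable_EFinP.
    apply: measurable_funM; last exact: measurable_cst.
    apply: measurable_funTS; exact: measurable_prod_kernel.
  move=> x Vx; rewrite !normrM; apply: ler_pM => //.
    by apply: FC; split.
  by apply: ler_pM.
rewrite [RHS](integralN (integrable_add_def mV i4)) -[LHS]oppeK; congr (- _)%E.
rewrite -[LHS]HH; apply: eq_integral => x _ /=; rewrite -EFinM; congr (_ * _)%:E.
have sJ := elem_smooth_prod_kernel sa.
rewrite mulrC -derive_prod_kernel//.
have dJ : derivable (prod_kernel a) x (delta_mx ord0 i).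
  exact/diff_derivable/elem_smooth_differentiable.
by have := deriveMl (k t) dJ; under eq_fun do rewrite mulrC.
Qed.

End integration_by_parts.

(** * Subsolutions tested with all derivatives on the kernel *)

Section subsolutions.
Context {R : realType} {n : nat}.
Local Notation mu := (@spacetime_measure R n).
Implicit Types (U : set 'rV[R]_n) (w : 'rV[R]_n * R -> R).

Lemma derive_eq0_off (k : R -> R) (u1 u2 : R) :
  (forall s, s < u1 \/ u2 < s -> k s = 0) ->
  forall s, s < u1 \/ u2 < s -> 'D_1 k s = 0.
Proof.
move=> k0 s su; rewrite -(derive_cst (0 : R) s 1); apply: near_eq_derive.
case: su => su.
  by near=> t; rewrite /= k0//; left; near: t; exact: lt_nbhsl.
by near=> t; rewrite /= k0//; right; near: t; exact: lt_nbhsr.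
Unshelve. all: by end_near. Qed.

Lemma elem_smooth_bounded_off (k : R -> R) (u1 u2 : R) : elem_smooth k ->
  (forall s, s < u1 \/ u2 < s -> k s = 0) ->
  exists2 C, 0 <= C & forall s, `|k s| <= C.
Proof.
move=> sk k0; apply: (@elem_smooth_bounded _ k (`|u1| + `|u2|) sk) => s.
have := ler_norm u2; have := ler_norm (- u1); rewrite normrN => h1 h2.
have := normr_ge0 u1; have := normr_ge0 u2.
move=> h3 h4 hs; apply: k0; move: hs; rewrite ltr_normr => /orP[hs|hs].
  by right; lra.
by left; lra.
Qed.

Lemma compactly_inside_ball U (c : 'rV[R]_n) (r : R) : 0 < r ->
  (forall x : 'rV[R]_n, (forall i, `|x ord0 i - c ord0 i| <= r) -> U x) ->
  compactly_inside (ball c r) U.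
Proof.
move=> r0 cU.
have sub : closure (ball c r) `<=` closed_box c r.
  have cB := compact_closed (@norm_hausdorff _ 'rV[R]_n) (@compact_closed_box R n c r).
  rewrite (proj1 (closure_id _) cB); apply: closureS => x /ball_rVE [_ H] i.
  by rewrite distrC ltW.
split; last exact: subset_trans sub cU.
apply: (subclosed_compact _ (@compact_closed_box R n c r) sub); exact: closed_closure.
Qed.

Lemma slab_sub_cylinder U (c : 'rV[R]_n) (r s1 s2 t1 t2 : R) :
  ball c r `<=` U -> t1 < s1 -> s2 < t2 -> slab c r s1 s2 `<=` cylinder U t1 t2.
Proof.
move=> cU ts1 st2 z [zc] /=; rewrite in_itv /= => /andP[z1 z2]; split; first exact: cU.
by rewrite /= in_itv /= (lt_trans ts1 z1) (lt_trans z2 st2).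
Qed.

(** The definition gives measurability of w^m only; w is recovered from it as the power 1/m, being
    nonnegative. *)
Lemma subsolution_measurable U (t1 t2 m : R) w (c : 'rV[R]_n) (r s1 s2 : R) :
  0 < m -> weak_subsolution m U t1 t2 (EFin \o w) ->
  0 < r -> compactly_inside (ball c r) U -> t1 < s1 -> s1 < s2 -> s2 < t2 ->
  measurable_fun (slab c r s1 s2) w /\
  measurable_fun (slab c r s1 s2) (fun z => w z `^ m).
Proof.
move=> m0 [w0 [g gL _]] r0 cU ts1 s12 st2.
have oV : open (ball c r) by exact: ball_open.
have [[mF _] _ _] := gL _ _ _ oV cU ts1 s12 st2.
have {}mF : measurable_fun (slab c r s1 s2) (fun z => w z `^ m).
  exact/measurable_EFinP.
split=> //.
have := measurableT_comp (measurable_powR m^-1) mF.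
apply: eq_measurable_fun => z; rewrite inE => Dz /=.
rewrite -powRrM divff ?gt_eqF// powRr1// -lee_fin; apply: w0.
apply: (slab_sub_cylinder _ ts1 st2) Dz; apply: subset_trans cU.2.
exact: subset_closure.
Qed.

(** Integrating the gradient term by parts turns the weak inequality into 0 <= int (w phi_t + w^m
    Laplacian phi). The weak gradient has disappeared, and only bounded weights remain. *)
Lemma weak_subsolution_kernel U (t1 t2 m : R) w (c : 'rV[R]_n) (r e s1 s2 u1 u2 : R)
    (a : 'I_n -> R -> R) (k : R -> R) (W : R) :
  0 < m -> weak_subsolution m U t1 t2 (EFin \o w) ->
  (forall z, cylinder U t1 t2 z -> w z <= W) ->
  0 < r -> e < r -> compactly_inside (ball c r) U ->
  t1 < s1 -> s1 < u1 -> s1 < s2 -> u2 < s2 -> s2 < t2 ->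
  (forall j, elem_smooth (a j)) ->
  (forall j s, e < `|s - c ord0 j| -> a j s = 0) ->
  (forall j s, 0 <= a j s) ->
  elem_smooth k -> (forall s, s < u1 \/ u2 < s -> k s = 0) -> (forall s, 0 <= k s) ->
  0 <= \int[mu]_(z in slab c r s1 s2) (w z * (prod_kernel a z.1 * 'D_1 k z.2)) +
   \sum_(i < n) \int[mu]_(z in slab c r s1 s2) (w z `^ m *
      (prod_kernel (derive_factor (derive_factor a i) i) z.1 * k z.2)).
Proof.
move=> m0 sub wW r0 er cU ts1 su1 s12 us2 st2 sa a0 a_ge0 sk k0 k_ge0.
have VU : ball c r `<=` U by apply: subset_trans cU.2; exact: subset_closure.
have DU := slab_sub_cylinder VU ts1 st2.
have [mw mF] := subsolution_measurable m0 sub r0 cU ts1 s12 st2.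
have [w0 [g gL gsub]] := sub.
have oV : open (ball c r) by exact: ball_open.
have {}gL := gL _ _ _ oV cU ts1 s12 st2.
have mD := measurable_slab c s1 s2 r0.
have Dy := slab_lty c s1 s2 r0.
have w_ge0 z : cylinder U t1 t2 z -> 0 <= w z by move=> /w0; rewrite lee_fin.
pose phi (z : 'rV[R]_n * R) := prod_kernel a z.1 * k z.2.
have phi_test : test_function (cylinder U t1 t2) phi.
  apply: (test_function_spacetime sa sk a0 k0) => z [z1 /=].
  rewrite in_itv /= => /andP[z2 z2']; apply: DU; split.
    exact: (box_sub_ball r0 er).
  by rewrite /= in_itv /= (lt_le_trans su1 z2) (le_lt_trans z2' us2).
have phi0 z : 0 <= phi z by rewrite mulr_ge0// prodr_ge0.
have {gsub} := gsub _ phi_test phi0.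
have k'0 := derive_eq0_off k0.
have sk' := @elem_smooth_derive R R^o k 1 sk.
have [Ck _ kC] := elem_smooth_bounded_off sk k0.
have [Ck' _ k'C] := elem_smooth_bounded_off sk' k'0.
pose X z := w z * (prod_kernel a z.1 * 'D_1 k z.2).
pose Y i (z : 'rV[R]_n * R) := g z ord0 i * (prod_kernel (derive_factor a i) z.1 * k z.2).
pose Z i (z : 'rV[R]_n * R) := w z `^ m *
      (prod_kernel (derive_factor (derive_factor a i) i) z.1 * k z.2).
(* The kernel is supported in the slab, where w is bounded and known to be measurable, so the
   integral over the cylinder is cut down to it. *)
have -> : weak_form U t1 t2 (EFin \o w) g phi =
  (\int[mu]_(z in slab c r s1 s2) (- (X z)%:E + \sum_(i < n) (Y i z)%:E))%E.
  rewrite /weak_form integral_mkcond [RHS]integral_mkcond.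
  apply: eq_integral => z _; rewrite !patchE.
  have E : (- ((EFin \o w) z * ('D_((0, 1) : 'rV[R]_n * R) phi z)%:E) +
      (\sum_(i < n) g z ord0 i * 'D_((delta_mx ord0 i, 0) : 'rV[R]_n * R) phi z)%:E =
      - (X z)%:E + \sum_(i < n) (Y i z)%:E)%E.
    rewrite sumEFin derive_time_kernel//; congr (_ + _%:E)%E.
    by apply: eq_bigr => i _; rewrite derive_space_kernel.
  rewrite E; case: ifPn => zC; case: ifPn => zD //; last first.
    by exfalso; move: zC => /negP; apply; rewrite inE; apply: DU; rewrite inE in zD.
  (* Off the slab either every spatial factor vanishes or both temporal ones do. Quantifying over
     [a'] treats the kernel and its spatial derivatives at once. *)
  have [az|kz] : (forall a', (forall j s, e < `|s - c ord0 j| -> a' j s = 0) ->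
      prod_kernel a' z.1 = 0) \/ (k z.2 = 0 /\ 'D_1 k z.2 = 0).
    have [zb|nzb] := pselect (closed_box c e z.1); last first.
      by left => a' a'0; exact: (prod_kernel_outside a'0).
    right; suff : z.2 < u1 \/ u2 < z.2 by move=> H; rewrite k0// k'0.
    apply: contrapT => /not_orP [/negP + /negP]; rewrite -!leNgt => h1 h2.
    move: zD => /negP; apply; rewrite inE; split; first exact: (box_sub_ball r0 er).
    by rewrite /= in_itv /= (lt_le_trans su1 h1) (le_lt_trans h2 us2).
  - rewrite /X az// mul0r mulr0 oppe0 add0e big1// => i _.
    by rewrite /Y az ?mul0r ?mulr0//; exact: derive_factor_eq0.
  - rewrite /X kz.2 !mulr0 oppe0 add0e big1// => i _.
    by rewrite /Y kz.1 !mulr0.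
have iw : mu.-integrable (slab c r s1 s2) (EFin \o w).
  apply: (@bounded_integrable _ _ _ _ _ _ W) => // z /DU zU.
  by rewrite ger0_norm ?w_ge0// wW.
have FC z : slab c r s1 s2 z -> `|w z `^ m| <= W `^ m.
  move=> /DU zU; rewrite ger0_norm ?powR_ge0// ge0_ler_powR ?nnegrE ?w_ge0//.
  - exact: ltW.
  - by apply: le_trans (wW _ zU); exact: w_ge0.
  - exact: wW.
have iF : mu.-integrable (slab c r s1 s2) (EFin \o (fun z => w z `^ m)).
  exact: (@bounded_integrable _ _ _ _ _ _ (W `^ m)).
have [Ca _ aC] := prod_kernel_bounded sa a0.
have iX : mu.-integrable (slab c r s1 s2) (EFin \o X).
  apply: (integrable_kernelM r0 (C := Ca * Ck') iw (measurable_kernel sa sk')) => z.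
  by rewrite normrM ler_pM.
have iY i : mu.-integrable (slab c r s1 s2) (EFin \o Y i).
  have [_ gi _] := gL.
  have [C _ HC] := prod_kernel_bounded (elem_smooth_derive_factor i sa) (derive_factor_eq0 i a0).
  have ig := square_integrable_integrable mD Dy (gi i).
  apply: (integrable_kernelM r0 (C := C * Ck) ig
    (measurable_kernel (elem_smooth_derive_factor i sa) sk)) => z.
  by rewrite normrM ler_pM.
have YZ i : (\int[mu]_(z in slab c r s1 s2) (Y i z)%:E =
    - \int[mu]_(z in slab c r s1 s2) (Z i z)%:E)%E.
  apply: (integral_by_parts r0 er i gL FC) kC => //.
  - exact: elem_smooth_derive_factor.
  - exact: derive_factor_eq0.
have iZ i : mu.-integrable (slab c r s1 s2) (EFin \o Z i).
  have sa2 := elem_smooth_derive_factor i (elem_smooth_derive_factor i sa).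
  have [C _ HC] := prod_kernel_bounded sa2 (derive_factor_eq0 i (derive_factor_eq0 i a0)).
  apply: (integrable_kernelM r0 (C := C * Ck) iF (measurable_kernel sa2 sk)) => z.
  by rewrite normrM ler_pM.
rewrite integralD//; last 2 first.
- exact: integrableN.
- apply: (@integrable_sum _ _ _ mu _ mD _ _ _ (fun i z => (Y i z)%:E)) => i _.
  exact: iY.
rewrite (integralN (integrable_add_def mD iX)) integral_sum//.
under eq_bigr do rewrite YZ.
have R_E f : mu.-integrable (slab c r s1 s2) (EFin \o f) ->
    (\int[mu]_(z in slab c r s1 s2) (f z)%:E =
     (\int[mu]_(z in slab c r s1 s2) f z)%:E)%E.
  by move=> If; rewrite /Rintegral fineK//; exact: integrable_fin_num.
rewrite (R_E _ iX); under eq_bigr do rewrite (R_E _ (iZ _)) -EFinN.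
rewrite sumEFin -EFinN -EFinD lee_fin sumrN -opprD oppr_le0.
by [].
Qed.

End subsolutions.

(** * Mollifying kernels *)

(* A is a smooth step from 0 to 1 across [-e, e]: its derivative is a bump of mass
   one, and [plateau t] is a mollified indicator of [t - h, t]. *)
Section bump_kernels.
Context {R : realType} {n : nat}.
Local Notation leb := (@lebesgue_measure R).
Local Notation mu := (@spacetime_measure R n).
Variables (A : R -> R) (e h : R).
Hypotheses (e0 : 0 < e) (eh : 2 * e < h) (sA : elem_smooth A)
  (hA : {homo A : s t / s <= t})
  (A0 : forall s, s <= - e -> A s = 0) (A1 : forall s, e <= s -> A s = 1).
Implicit Types (y : 'rV[R]_n) (s t : R).

Definition step_bump s : R := 'D_1 A s.

Definition space_bump y (j : 'I_n) s : R := step_bump (s - y ord0 j).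

Definition plateau t s : R := A (s - t + h) - A (s - t).

Lemma elem_smooth_bump : elem_smooth step_bump.
Proof. exact: (@elem_smooth_derive R R^o). Qed.

Lemma elem_smooth_shift (f : R -> R) t : elem_smooth f -> elem_smooth (fun s => f (s - t)).
Proof.
move=> sf; apply: (elem_smooth_comp_real sf).
exact: ES_add elem_smooth_id (ES_cst _).
Qed.

Lemma derive_elem_smooth_shift (f : R -> R) t s : elem_smooth f ->
  'D_1 (fun s => f (s - t)) s = 'D_1 f (s - t).
Proof.
move=> sf.
have := @is_derive_line _ f ('D_1 f) s (- t) (fun u => elem_smooth_is_derive u sf).
have -> : (fun u => f (- t + u)) = (fun u => f (u - t)).
  by apply/funext => u; rewrite addrC.
by rewrite addrC => -[].
Qed.

Lemma bump_ge0 s : 0 <= step_bump s.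
Proof. by apply: derive_homo_ge0 => //; have [] := elem_smooth_is_derive s sA. Qed.

Lemma bump_eq0 s : e < `|s| -> step_bump s = 0.
Proof. exact: derive_step_eq0. Qed.

Lemma elem_smooth_space_bump y j : elem_smooth (space_bump y j).
Proof. exact: (elem_smooth_shift _ elem_smooth_bump). Qed.

Lemma space_bump_ge0 y j s : 0 <= space_bump y j s.
Proof. exact: bump_ge0. Qed.

Lemma space_bump_eq0 y j s : e < `|s - y ord0 j| -> space_bump y j s = 0.
Proof. exact: bump_eq0. Qed.

Lemma step_itv s : 0 <= A s <= 1.
Proof.
apply/andP; split.
  have [se|se] := leP s (- e); first by rewrite A0.
  by rewrite -(A0 (lexx (- e))) hA// ltW.
have [se|se] := leP e s; first by rewrite A1.
by rewrite -(A1 (lexx e)) hA// ltW.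
Qed.

Lemma elem_smooth_plateau t : elem_smooth (plateau t).
Proof.
have s1 : elem_smooth (fun s => A (s - (t - h))) by exact: elem_smooth_shift.
have s2 : elem_smooth (fun s => -1 * A (s - t)).
  by apply: ES_mul (ES_cst _) _; exact: elem_smooth_shift.
by apply: (eq_elem_smooth (ES_add s1 s2)) => s; rewrite /plateau mulN1r opprB addrA addrAC.
Qed.

Lemma plateau_ge0 t s : 0 <= plateau t s.
Proof.
rewrite /plateau subr_ge0 hA// lerDl ltW// (lt_trans _ eh)//.
by rewrite mulr_gt0.
Qed.

Lemma plateau_le1 t s : plateau t s <= 1.
Proof.
rewrite /plateau; have /andP[_ h1] := step_itv (s - t + h).
by have /andP[h2 _] := step_itv (s - t); lra.
Qed.

Lemma plateau_eq0 t s : s < t - h - e \/ t + e < s -> plateau t s = 0.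
Proof.
move=> H; rewrite /plateau; move: (e0) (eh) => p0 p1; case: H => H.
  by rewrite [A (s - t + h)]A0 ?[A (s - t)]A0 ?subrr//; lra.
by rewrite [A (s - t + h)]A1 ?[A (s - t)]A1 ?subrr//; lra.
Qed.

Lemma plateau_eq1 t s : t - h + e <= s <= t - e -> plateau t s = 1.
Proof. move=> /andP[h1 h2]; rewrite /plateau [A (s - t + h)]A1; last by lra.
by rewrite [A (s - t)]A0 ?subr0//; lra. Qed.

(** One bump for each end of the mollified indicator, with opposite signs: integrated against this,
    a function yields its average near t - h minus its average near t. *)
Lemma derive_plateau t s : 'D_1 (plateau t) s = step_bump (s - (t - h)) - step_bump (s - t).
Proof.
have s1 : elem_smooth (fun s => A (s - (t - h))) by exact: elem_smooth_shift.
have s2 : elem_smooth (fun s => A (s - t)) by exact: elem_smooth_shift.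
have -> : plateau t = (fun s => A (s - (t - h))) - (fun s => A (s - t)).
  by apply/funext => u; rewrite /plateau !fctE opprB addrA addrAC.
rewrite deriveB; last 2 first.
- by have [] := elem_smooth_is_derive s s1.
- by have [] := elem_smooth_is_derive s s2.
by rewrite !derive_elem_smooth_shift.
Qed.

(** Turns increments in the parameter t into increments in the variable s, where the Taylor
    estimates apply. *)
Lemma plateau_shift t s u : plateau (t - u) s = plateau t (s + u).
Proof. by rewrite /plateau; congr (A _ - A _); ring. Qed.

Lemma space_mass y : (\int[lebesgue_rV n]_x (prod_kernel (space_bump y) x)%:E = 1)%E.
Proof.
apply: (integral_rV_prod (f := space_bump y)).
- by move=> i; apply: measurable_elem_smooth; exact: elem_smooth_space_bump.
- by move=> i s; exact: space_bump_ge0.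
- by move=> i; exact: (integral_derive_step _ e0 sA A0 A1).
Qed.

Lemma prod_space_bump_ge0 y x : 0 <= prod_kernel (space_bump y) x.
Proof. by apply: prodr_ge0 => i _; exact: space_bump_ge0. Qed.

Lemma kernel_mass y (k : R -> R) : elem_smooth k -> (forall s, 0 <= k s) ->
  (\int[mu]_z (prod_kernel (space_bump y) z.1 * k z.2)%:E = \int[leb]_s (k s)%:E)%E.
Proof.
move=> sk k0; apply: integral_kernel => //.
- by apply: measurable_prod_kernel => i; exact: elem_smooth_space_bump.
- exact: measurable_elem_smooth.
- exact: prod_space_bump_ge0.
- exact: space_mass.
Qed.

Lemma bump_mass y t :
  (\int[mu]_z (prod_kernel (space_bump y) z.1 * step_bump (z.2 - t))%:E = 1)%E.
Proof.
rewrite (@kernel_mass y (fun s => step_bump (s - t))).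
- exact: (integral_derive_step _ e0 sA A0 A1).
- exact: (elem_smooth_shift _ elem_smooth_bump).
- by move=> s; exact: bump_ge0.
Qed.

Lemma integral_itv_cst (a b : R) : a <= b -> (\int[leb]_(s in `[a, b]) 1%E = (b - a)%:E)%E.
Proof.
move=> ab; rewrite integral_cst//= mul1e lebesgue_measure_itv/= lte_fin.
by case: ltgtP ab => // -> _; rewrite subrr.
Qed.

(** The plateau lies below the indicator of [t - h - e, t + e]; the lower bound that follows
    compares it with the indicator of [t - h + e, t - e]. *)
Lemma plateau_mass_le y t :
  (\int[mu]_z (prod_kernel (space_bump y) z.1 * plateau t z.2)%:E <= (h + 2 * e)%:E)%E.
Proof.
rewrite kernel_mass; [|exact: elem_smooth_plateau|exact: plateau_ge0].
move: (e0) (eh) => p0 p1.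
have -> : h + 2 * e = (t + e) - (t - h - e) by ring.
rewrite -integral_itv_cst; last by lra.
rewrite [leRHS]integral_mkcond; apply: ge0_le_integral => //.
- by move=> s _; rewrite lee_fin plateau_ge0.
- by apply/measurable_EFinP; exact: (measurable_elem_smooth (elem_smooth_plateau t)).
- by apply/(measurable_restrictT _ _).1 => //; exact: measurable_cst.
- move=> s _; rewrite patchE; case: ifPn => sI; first by rewrite lee_fin plateau_le1.
  rewrite plateau_eq0//; move: sI; rewrite notin_setE /= in_itv /= => /negP.
  by rewrite negb_and -!ltNge => /orP[]; [left|right].
Qed.

Lemma plateau_mass_ge y t :
  ((h - 2 * e)%:E <= \int[mu]_z (prod_kernel (space_bump y) z.1 * plateau t z.2)%:E)%E.
Proof.
rewrite kernel_mass; [|exact: elem_smooth_plateau|exact: plateau_ge0].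
move: (e0) (eh) => p0 p1.
have -> : h - 2 * e = (t - e) - (t - h + e) by ring.
rewrite -integral_itv_cst; last by lra.
rewrite [leLHS]integral_mkcond; apply: ge0_le_integral => //.
- by move=> s _; rewrite patchE; case: ifP.
- by apply/(measurable_restrictT _ _).1 => //; exact: measurable_cst.
- by apply/measurable_EFinP; exact: (measurable_elem_smooth (elem_smooth_plateau t)).
- move=> s _; rewrite patchE; case: ifPn => [|_]; last by rewrite lee_fin plateau_ge0.
  by rewrite inE /= in_itv /= => sI; rewrite plateau_eq1.
Qed.

End bump_kernels.

(** * Compactness and real estimates *)

Section compactness.
Context {R : realType} {T : pseudoMetricType R}.
Implicit Types (Q O : set T) (f : T -> R).

Lemma near_right_itv (a : R) : 0 < a -> \forall u \near 0^'+, `]0, a[%classic u.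
Proof.
move=> a0; near=> u; rewrite /= in_itv /=; apply/andP; split; near: u.
  exact: nbhs_right_gt.
exact: nbhs_right_lt.
Unshelve. all: by end_near. Qed.

Lemma within_continuous_near Q f x o : {within Q, continuous f} -> Q x -> 0 < o ->
  \forall z \near x, Q z -> `|f x - f z| < o.
Proof.
move=> cf Qx o0; have /subspace_continuousP/(_ x Qx)/cvgrPdist_lt/(_ _ o0) := cf.
by [].
Qed.

(** A radius good for oscillation o / 2 at x, once halved, serves all points near x by the triangle
    inequality; compactness makes it uniform. *)
Lemma within_continuous_unif Q f o : compact Q -> {within Q, continuous f} -> 0 < o ->
  exists2 d, 0 < d & forall z z', Q z -> Q z' -> ball z d z' -> `|f z - f z'| < o.
Proof.
move=> /compact_near_coveringP cQ cf o0.
pose P (d : R) z := Q z -> forall z', Q z' -> ball z d z' -> `|f z - f z'| < o.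
have H x : Q x -> \forall z \near x & d \near (0:R)^'+, P d z.
  move=> Qx; have o20 : 0 < o / 2 by rewrite divr_gt0.
  have /nbhs_ballP[d /= d0 Hd] := within_continuous_near cf Qx o20.
  exists (ball x (d / 2), `]0, (d / 2)[%classic).
    split; first by apply: nbhsx_ballx; rewrite divr_gt0.
    by apply: near_right_itv; rewrite divr_gt0.
  move=> [z u] [/= xz]; rewrite in_itv /= => /andP[u0 ud] Qz z' Qz' zz'.
  have xz' : ball x d z'.
    rewrite (splitr d); apply: ball_triangle xz _; apply: le_ball zz'; exact: ltW.
  have {}xz : ball x d z by apply: le_ball xz; lra.
  have := Hd _ xz Qz; have := Hd _ xz' Qz' => h1 h2.
  rewrite (splitr o); apply: le_lt_trans (ltrD h2 h1).
  by rewrite -[`|f x - f z|]normrN opprB; apply: le_trans (ler_normD _ _); rewrite addrA subrK.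
have HP := cQ _ _ P _ H.
near (0:R)^'+ => d; exists d; first by near: d; exact: nbhs_right_gt.
move=> z z' Qz Qz' zz'; have : Q `<=` P d by near: d; exact: HP.
by move=> /(_ z Qz); apply.
Unshelve. all: by end_near. Qed.

(** Locally there are two cases: if f x >= c, then x has a ball inside O; if f x < c, continuity
    makes the condition c <= f z fail nearby and the claim is void there. Compactness makes the
    radius uniform. *)
Lemma compact_superlevel_ball Q O f c : compact Q -> {within Q, continuous f} -> open O ->
  (forall z, Q z -> c <= f z -> O z) ->
  exists2 d, 0 < d & forall z, Q z -> c <= f z -> ball z d `<=` O.
Proof.
move=> /compact_near_coveringP cQ cf oO fO.
pose P (d : R) z := Q z -> c <= f z -> ball z d `<=` O.
have H x : Q x -> \forall z \near x & d \near (0:R)^'+, P d z.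
  move=> Qx; have [fx|fx] := leP c (f x).
    have Ox := fO _ Qx fx.
    have /nbhs_ballP[d /= d0 Hd] := open_nbhs_nbhs (conj oO Ox).
    exists (ball x (d / 2), `]0, (d / 2)[%classic).
      split; first by apply: nbhsx_ballx; rewrite divr_gt0.
      by apply: near_right_itv; rewrite divr_gt0.
    move=> [z u] [/= xz]; rewrite in_itv /= => /andP[u0 ud] Qz _ z' zz'.
    apply: Hd; rewrite (splitr d); apply: ball_triangle xz _; apply: le_ball zz'; exact: ltW.
  have o0 : 0 < c - f x by rewrite subr_gt0.
  have /nbhs_ballP[d /= d0 Hd] := within_continuous_near cf Qx o0.
  exists (ball x d, setT); first by split; [exact: nbhsx_ballx|exact: filterT].
  move=> [z u] [/= xz _] Qz; have := Hd _ xz Qz; rewrite ltr_norml => /andP[h1 h2] h3.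
  by lra.
have HP := cQ _ _ P _ H.
near (0:R)^'+ => d; exists d; first by near: d; exact: nbhs_right_gt.
move=> z Qz fz; have : Q `<=` P d by near: d; exact: HP.
by move=> /(_ z Qz); apply.
Unshelve. all: by end_near. Qed.

Lemma within_continuous_bounded Q f : compact Q -> {within Q, continuous f} ->
  exists2 W, 0 <= W & forall z, Q z -> f z <= W.
Proof.
move=> cQ cf; have [->|/set0P[z0 Qz0]] := eqVneq Q set0.
  by exists 0.
have [z _ Hz] := compact_EVT_max (ex_intro _ z0 Qz0) cQ cf.
exists `|f z| => // y Qy; apply: le_trans (ler_norm _); apply: Hz.
by rewrite inE.
Qed.

End compactness.

Section reals.
Context {R : realType}.

(** The mean value theorem for a > 0, with x^(m-1) <= W^(m-1) because m > 1. The derivative formula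
    is for positive x, so a = 0 is treated directly by b^m = b b^(m-1). *)
Lemma powR_lipschitz (m W a b : R) : 1 < m -> 0 <= a -> a <= b -> b <= W ->
  b `^ m - a `^ m <= m * W `^ (m - 1) * (b - a).
Proof.
move=> m1 a0 ab bW.
have b0 := le_trans a0 ab; have m0 : 0 < m by rewrite (lt_trans _ m1).
have bWm : forall x, 0 <= x -> x <= W -> x `^ (m - 1) <= W `^ (m - 1).
  move=> x x0 xW; apply: ge0_ler_powR; rewrite ?nnegrE ?subr_ge0 ?(ltW m1)//.
  exact: le_trans xW.
move: a0; rewrite le_eqVlt => /predU1P[a0|a0].
  rewrite -a0 powR0 ?gt_eqF// !subr0.
  have -> : b `^ m = b * b `^ (m - 1).
    have [->|bn0] := eqVneq b 0; first by rewrite mul0r powR0// gt_eqF.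
    rewrite -{2}(powRr1 b0) -powRD; last by apply/implyP.
    by congr (_ `^ _); ring.
  rewrite mulrC ler_wpM2r//; apply: le_trans (bWm _ b0 bW) _.
  by rewrite ler_peMl ?powR_ge0// ltW.
have dp (x : R) : 0 < x -> is_derive x 1 (@powR R ^~ m) (m * x `^ (m - 1)).
  by move=> x0; exact: is_derive1_powR.
have cont : {within `[a, b], continuous (@powR R ^~ m)}.
  apply: derivable_within_continuous => x; rewrite in_itv /= => /andP[ax _].
  by have [] := dp x (lt_le_trans a0 ax).
have dd (x : R) : x \in `]a, b[ -> is_derive x 1 (@powR R ^~ m) (m * x `^ (m - 1)).
  by rewrite in_itv /= => /andP[ax _]; apply: dp; exact: lt_trans ax.
have [c] := MVT_segment ab dd cont.
rewrite in_itv /= => /andP[ac cb] ->.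
rewrite ler_wpM2r ?subr_ge0// ler_wpM2l ?(ltW m0)// bWm ?(le_trans cb)//.
by rewrite (le_trans (ltW a0)).
Qed.

End reals.

Section averages.
Context d (T : measurableType d) (R : realType) (mu : {measure set T -> \bar R}).
Implicit Types (D : set T) (f K : T -> R).

Lemma Rintegral_support D f : (forall z, ~ D z -> f z = 0) ->
  \int[mu]_z f z = \int[mu]_(z in D) f z.
Proof.
move=> f0; rewrite [RHS]Rintegral_mkcond; congr Rintegral; apply/funext => z.
by rewrite patchE; case: ifPn => //; rewrite notin_setE => /f0.
Qed.

(** The bound on f is asked only where K does not vanish, since f is controlled only on the small
    support of a kernel. *)
Lemma Rintegral_kernel_le D f K c : measurable D ->
  mu.-integrable D (EFin \o K) -> mu.-integrable D (EFin \o (fun z => f z * K z)) ->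
  (forall z, D z -> 0 <= K z) -> (forall z, D z -> K z != 0 -> f z <= c) ->
  \int[mu]_(z in D) (f z * K z) <= c * \int[mu]_(z in D) K z.
Proof.
move=> mD iK ifK K0 fc; rewrite -RintegralZl//; apply: le_Rintegral => //.
  exact: (@integrableZl _ _ _ mu D mD c (EFin \o K)).
move=> z Dz; have [->|Kz] := eqVneq (K z) 0; first by rewrite !mulr0.
by rewrite ler_wpM2r ?K0// fc.
Qed.

Lemma Rintegral_kernel_ge D f K c : measurable D ->
  mu.-integrable D (EFin \o K) -> mu.-integrable D (EFin \o (fun z => f z * K z)) ->
  (forall z, D z -> 0 <= K z) -> (forall z, D z -> K z != 0 -> c <= f z) ->
  c * \int[mu]_(z in D) K z <= \int[mu]_(z in D) (f z * K z).
Proof.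
move=> mD iK ifK K0 fc; rewrite -RintegralZl//; apply: le_Rintegral => //.
  exact: (@integrableZl _ _ _ mu D mD c (EFin \o K)).
move=> z Dz; have [->|Kz] := eqVneq (K z) 0; first by rewrite !mulr0.
by rewrite ler_wpM2r ?K0// fc.
Qed.

Lemma Rintegral_le_cst D f c : measurable D -> (mu D < +oo)%E ->
  mu.-integrable D (EFin \o f) -> (forall z, D z -> f z <= c) ->
  \int[mu]_(z in D) f z <= c * fine (mu D).
Proof.
move=> mD Dy iF fc; rewrite -Rintegral_cst//; apply: le_Rintegral => //.
apply: measurable_bounded_integrable => //.
exists `|c|; split; first exact: num_real.
by move=> M CM x _; exact: ltW.
Qed.

End averages.

(** * Comparison at an approximate maximum *)

Section weighted_integral.
Context d (T : measurableType d) (R : realType) (mu : {measure set T -> \bar R}).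
Variables (D : set T) (F : T -> R) (CF : R).
Hypotheses (mD : measurable D) (Dy : (mu D < +oo)%E) (mF : measurable_fun D F)
  (F0 : forall z, D z -> 0 <= F z) (FC : forall z, D z -> F z <= CF).
Implicit Types (K : T -> R).

Definition bounded_measurable K :=
  measurable_fun setT K /\ exists C, forall z, `|K z| <= C.

Lemma bounded_measurableD K K' : bounded_measurable K -> bounded_measurable K' ->
  bounded_measurable (fun z => K z + K' z).
Proof.
move=> [mK [C HC]] [mK' [C' HC']]; split; first exact: measurable_funD.
by exists (C + C') => z; rewrite (le_trans (ler_normD _ _))// lerD.
Qed.

Lemma bounded_measurableZ (c : R) K : bounded_measurable K ->
  bounded_measurable (fun z => c * K z).
Proof.
move=> [mK [C HC]]; split; first by apply: measurable_funM => //; exact: measurable_cst.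
by exists (`|c| * C) => z; rewrite normrM ler_wpM2l.
Qed.

Lemma bounded_measurable_integrable K : bounded_measurable K -> mu.-integrable D (EFin \o K).
Proof.
move=> [mK [C HC]]; apply: (@bounded_integrable _ _ _ _ _ _ C) => //.
exact: measurable_funTS.
Qed.

Lemma weighted_integrable K : bounded_measurable K ->
  mu.-integrable D (EFin \o (fun z => F z * K z)).
Proof.
move=> [mK [C HC]]; apply: (@bounded_integrable _ _ _ _ _ _ (CF * C)) => //.
  by apply: measurable_funM => //; exact: measurable_funTS.
move=> z Dz; rewrite normrM ler_pM// ger0_norm; [exact: FC|exact: F0].
Qed.

Lemma weightedD K K' : bounded_measurable K -> bounded_measurable K' ->
  \int[mu]_(z in D) (F z * (K z + K' z)) =
  \int[mu]_(z in D) (F z * K z) + \int[mu]_(z in D) (F z * K' z).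
Proof.
move=> bK bK'; under eq_Rintegral do rewrite mulrDr.
by apply: RintegralD => //; exact: weighted_integrable.
Qed.

Lemma weightedZ (c : R) K : bounded_measurable K ->
  \int[mu]_(z in D) (F z * (c * K z)) = c * \int[mu]_(z in D) (F z * K z).
Proof.
move=> bK; under eq_Rintegral do rewrite mulrCA.
by apply: RintegralZl => //; exact: weighted_integrable.
Qed.

(** Since F >= 0, an upper bound on K carries over to the integral. This turns pointwise
    inequalities between kernels into inequalities between means of F. *)
Lemma weighted_le_cst K (c : R) : bounded_measurable K -> 0 <= c ->
  (forall z, D z -> K z <= c) ->
  \int[mu]_(z in D) (F z * K z) <= CF * c * fine (mu D).
Proof.
move=> bK c0 Kc; apply: Rintegral_le_cst => //; first exact: weighted_integrable.
move=> z Dz; have [K0|K0] := leP 0 (K z).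
  by rewrite ler_pM ?F0 ?FC ?Kc.
have CF0 : 0 <= CF := le_trans (F0 Dz) (FC Dz).
by apply: (@le_trans _ _ 0); [rewrite mulr_ge0_le0 ?F0// ltW|rewrite mulr_ge0].
Qed.

End weighted_integral.

(** * Kernel bounds uniform in the centre *)

Section kernel_estimates.
Context {R : realType} {n : nat}.
Local Notation mu := (@spacetime_measure R n).

(** A ball of the sup norm lies in a box of side 2 r. The bound is free of the centre, so the error
    constants can be fixed before the approximate maximum is known. *)
Lemma slab_measure_le (c : 'rV[R]_n) (r s1 s2 : R) : 0 < r -> s1 < s2 ->
  fine (mu (slab c r s1 s2)) <= (2 * r) ^+ n * (s2 - s1).
Proof.
move=> r0 s12.
have sy := slab_lty c s1 s2 r0.
rewrite -lee_fin fineK; last by rewrite ge0_fin_numE.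
have mI : measurable (`]s1, s2[%classic : set (measurableTypeR R)).
  exact: measurable_itv.
rewrite /slab /spacetime_measure /= product_measure1E//; last exact: measurable_ball_rV.
have I1 : (lebesgue_measure (`]s1, s2[%classic : set R) = (s2 - s1)%:E)%E.
  by rewrite lebesgue_measure_itv /= lte_fin s12.
rewrite EFinM; apply: lee_pmul => //; last by rewrite [leLHS]I1.
pose a := \row_i (c ord0 i - r); pose b := \row_i (c ord0 i + r).
apply: (@le_trans _ _ (lebesgue_rV n
    [set x | forall i, a ord0 i <= x ord0 i <= b ord0 i])).
  apply: le_measure; rewrite ?inE; [exact: measurable_ball_rV|exact: measurable_closed_box|].
  move=> x /ball_rVE [_ H] i; rewrite !mxE -ler_distl distrC.
  exact: ltW.
rewrite lebesgue_rV_box; last by move=> i; rewrite !mxE; lra.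
rewrite lee_fin (eq_bigr (fun=> 2 * r)).
  by rewrite prodr_const card_ord.
by move=> i _; rewrite !mxE; ring.
Qed.

Lemma bounded_measurable_kernel (a : 'I_n -> R -> R) (c : 'rV[R]_n) (e : R) (k : R -> R) (Ck : R) :
  (forall j, elem_smooth (a j)) -> (forall j s, e < `|s - c ord0 j| -> a j s = 0) ->
  elem_smooth k -> (forall s, `|k s| <= Ck) ->
  bounded_measurable (fun z : 'rV[R]_n * measurableTypeR R => prod_kernel a z.1 * k z.2).
Proof.
move=> sa a0 sk kC; split; first exact: measurable_kernel.
have [C C0 HC] := prod_kernel_bounded sa a0.
by exists (C * Ck) => z; rewrite normrM ler_pM.
Qed.

Variables (A : R -> R) (e : R).
Hypotheses (e0 : 0 < e) (sA : elem_smooth A)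
  (A0 : forall s, s <= - e -> A s = 0) (A1 : forall s, e <= s -> A s = 1).
Local Notation sb := (space_bump A).

Lemma derive2_elem_smooth_shift (f : R -> R) (c s : R) : elem_smooth f ->
  'D_1 ('D_1 (fun s => f (s - c))) s = 'D_1 ('D_1 f) (s - c).
Proof.
move=> sf; have E : 'D_1 (fun s => f (s - c)) = (fun s => 'D_1 f (s - c)).
  by apply/funext => u; exact: (derive_elem_smooth_shift c u sf).
apply: etrans (congr1 (fun g : R -> R => 'D_1 g s) E) _.
exact: (derive_elem_smooth_shift c s (@elem_smooth_derive R R^o f 1 sf)).
Qed.

Lemma derive_factor2 (a : 'I_n -> R -> R) i :
  derive_factor (derive_factor a i) i i = 'D_1 ('D_1 (a i)).
Proof. by rewrite /derive_factor eqxx. Qed.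

Lemma space_bump_second (y : 'rV[R]_n) i s :
  derive_factor (derive_factor (sb y) i) i i s = 'D_1 ('D_1 (step_bump A)) (s - y ord0 i).
Proof.
apply: etrans (congr1 (fun g : R -> R => g s) (derive_factor2 (sb y) i)) _.
exact: (derive2_elem_smooth_shift (y ord0 i) s (elem_smooth_bump sA)).
Qed.

Let second_difference_factor (p1 p2 p3 p4 q b1 b2 b3 b4 t B C : R) :
  p1 = q * b1 -> p2 = q * b2 -> p3 = q * b3 -> p4 = q * b4 -> `|q| <= B ->
  `|b2 + b1 - 2 * b3 - t ^+ 2 * b4| <= C ->
  `|p1 + p2 - 2 * p3 - t ^+ 2 * p4| <= B * C.
Proof.
move=> -> -> -> -> qB bC.
have -> : q * b1 + q * b2 - 2 * (q * b3) - t ^+ 2 * (q * b4) =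
    q * (b2 + b1 - 2 * b3 - t ^+ 2 * b4) by ring.
by rewrite normrM ler_pM.
Qed.

(** A shift of the centre along one axis changes a single factor; the others come out as q, and the
    one-variable estimate remains. *)
Lemma prod_kernel_second_difference (y x : 'rV[R]_n) i (t B C : R) : 0 <= t -> 1 <= B ->
  (forall s, `|step_bump A s| <= B) -> (forall s, `|'D_1 ('D_1 ('D_1 (step_bump A))) s| <= C) ->
  `|prod_kernel (sb (t *: delta_mx ord0 i + y)) x +
    prod_kernel (sb ((- t) *: delta_mx ord0 i + y)) x -
    2 * prod_kernel (sb y) x -
    t ^+ 2 * prod_kernel (derive_factor (derive_factor (sb y) i) i) x| <=
  B ^+ n * (3 * C * t ^+ 3).
Proof.
move=> t0 B1 bB bC.
pose q := \prod_(j | j != i) sb y j (x ord0 j).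
pose u := x ord0 i - y ord0 i.
have shift (v : R) : prod_kernel (sb (v *: delta_mx ord0 i + y)) x = q * step_bump A (u - v).
  rewrite /prod_kernel (bigD1 i)//= mulrC; congr (_ * _).
    apply: eq_bigr => j ji; rewrite /space_bump !mxE (negbTE ji) andbF.
    by rewrite mulr0 add0r.
  by rewrite /space_bump !mxE !eqxx mulr1 /u; congr (step_bump A _); ring.
have E2 : prod_kernel (sb y) x = q * step_bump A u by rewrite /prod_kernel (bigD1 i)//= mulrC.
have E3 : prod_kernel (derive_factor (derive_factor (sb y) i) i) x =
    q * 'D_1 ('D_1 (step_bump A)) u.
  rewrite /prod_kernel (bigD1 i)//= mulrC; congr (_ * _); last exact: space_bump_second.
  by apply: eq_bigr => j ji; rewrite /derive_factor (negbTE ji).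
have sN := shift (- t); rewrite opprK in sN.
have qB : `|q| <= B ^+ n.
  rewrite /q normr_prod big_mkcond /=.
  have -> : B ^+ n = \prod_(j < n) B by rewrite prodr_const card_ord.
  (* The factor missing from q counts as 1, and 1 <= B. *)
  apply: ler_prod => j _; case: ifP => _; last by rewrite ler01.
  by rewrite normr_ge0 bB.
have H := second_difference u (elem_smooth_bump sA) t0 bC.
exact: (second_difference_factor (shift t) sN E2 E3 qB H).
Qed.

End kernel_estimates.

Section arithmetic.
Context {R : realType}.
Implicit Types (p q r u k : R).

Lemma second_difference_kernel_le (pp pm p0 l r T X : R) :
  0 <= r <= 1 -> `|pp + pm - 2 * p0 - T * l| <= X ->
  T * (l * r) + (2 * (p0 * r) + (-1 * (pp * r) + -1 * (pm * r))) <= X.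
Proof.
move=> /andP[r0 r1] H.
have -> : T * (l * r) + (2 * (p0 * r) + (-1 * (pp * r) + -1 * (pm * r))) =
  - (pp + pm - 2 * p0 - T * l) * r by ring.
apply: le_trans (ler_norm _) _; rewrite normrM normrN (ger0_norm r0).
apply: le_trans H; exact: ler_piMr.
Qed.

(** Division by u^2: the errors u^3 of the two shifted means give 2 u, the Taylor remainder gives
    the rest. *)
Lemma space_step_arith (u k WF mu vol Il I0 Ip Im : R) :
  0 < u -> 0 <= WF * k -> mu <= vol -> Ip <= I0 + u ^+ 3 -> Im <= I0 + u ^+ 3 ->
  u ^+ 2 * Il + (2 * I0 + (-1 * Ip + -1 * Im)) <= WF * (k * u ^+ 3) * mu ->
  Il <= (2 + WF * k * vol) * u.
Proof.
move=> u0 k0 muv hp hm H.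
have u2 : 0 < u ^+ 2 by rewrite exprn_gt0.
have u3 : 0 <= u ^+ 3 by rewrite exprn_ge0// ltW.
rewrite -(ler_pM2l u2).
have -> : u ^+ 2 * ((2 + WF * k * vol) * u) = 2 * u ^+ 3 + WF * k * u ^+ 3 * vol by ring.
have : WF * k * u ^+ 3 * mu <= WF * k * u ^+ 3 * vol by rewrite ler_wpM2l// mulr_ge0.
by move: H; rewrite mulrA; lra.
Qed.

(** Division by u: the penalty d u becomes the gain -d, and the error u^3 is at most u^2 because u
    <= 1. *)
Lemma time_step_arith (u k WF mu vol Ir I0 I1 d : R) :
  0 < u -> u <= 1 -> 0 <= WF * k -> mu <= vol -> I1 + d * u <= I0 + u ^+ 3 ->
  u * Ir + (I0 + -1 * I1) <= WF * (k * u ^+ 2) * mu ->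
  Ir <= - d + (1 + WF * k * vol) * u.
Proof.
move=> u0 u1 k0 muv h1 H.
have u2 : 0 <= u ^+ 2 by rewrite exprn_ge0// ltW.
have u32 : u ^+ 3 <= u ^+ 2 by rewrite exprSr ler_piMr.
rewrite -(ler_pM2l u0).
have -> : u * (- d + (1 + WF * k * vol) * u) =
  - (d * u) + u ^+ 2 + WF * k * u ^+ 2 * vol by ring.
have : WF * k * u ^+ 2 * mu <= WF * k * u ^+ 2 * vol by rewrite ler_wpM2l// mulr_ge0.
by move: H; rewrite mulrA; lra.
Qed.

End arithmetic.

Section plateau_second_derivative.
Context {R : realType}.

Lemma derive_shiftB (f : R -> R) (a b s : R) : elem_smooth f ->
  'D_1 (fun s => f (s - a) - f (s - b)) s = 'D_1 f (s - a) - 'D_1 f (s - b).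
Proof.
move=> sf.
have sa := elem_smooth_shift a sf; have sb := elem_smooth_shift b sf.
rewrite -(derive_elem_smooth_shift a s sf) -(derive_elem_smooth_shift b s sf).
apply: (@deriveB _ _ _ (fun s => f (s - a)) (fun s => f (s - b))).
  by have [] := elem_smooth_is_derive s sa.
by have [] := elem_smooth_is_derive s sb.
Qed.

Lemma derive2_plateau (A : R -> R) (h t s : R) : elem_smooth A ->
  'D_1 ('D_1 (plateau A h t)) s = 'D_1 (step_bump A) (s - (t - h)) - 'D_1 (step_bump A) (s - t).
Proof.
move=> sA.
have E : 'D_1 (plateau A h t) = (fun s => step_bump A (s - (t - h)) - step_bump A (s - t)).
  by apply/funext => v; exact: derive_plateau.
apply: etrans (congr1 (fun g : R -> R => 'D_1 g s) E) _.
exact: (derive_shiftB (t - h) t s (elem_smooth_bump sA)).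
Qed.

Lemma first_difference_kernel_le (p a b r u B C : R) : 0 <= C ->
  `|p| <= B -> `|b - a - u * r| <= C ->
  u * (p * r) + (p * a + -1 * (p * b)) <= B * C.
Proof.
move=> C0 pB H; have -> : u * (p * r) + (p * a + -1 * (p * b)) = - (p * (b - a - u * r)) by ring.
by apply: le_trans (ler_norm _) _; rewrite normrN normrM ler_pM.
Qed.

End plateau_second_derivative.

(** * Shifting the kernel at an approximate maximum of the mean *)

Section near_maximum.
Context {R : realType} {n : nat}.
Local Notation mu := (@spacetime_measure R n).
Variables (U : set 'rV[R]_n) (t1 t2 m W : R) (w : 'rV[R]_n * R -> R).
Variables (A : R -> R) (e h s1 s2 B C2 C3 : R).
Hypotheses (m0 : 0 < m) (sub : weak_subsolution m U t1 t2 (EFin \o w))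
  (wW : forall z, cylinder U t1 t2 z -> w z <= W)
  (ts1 : t1 < s1) (s12 : s1 < s2) (st2 : s2 < t2).
Hypotheses (e0 : 0 < e) (eh : 2 * e < h) (sA : elem_smooth A)
  (hA : {homo A : s t / s <= t})
  (A0 : forall s, s <= - e -> A s = 0) (A1 : forall s, e <= s -> A s = 1).
Hypotheses (B1 : 1 <= B) (bB : forall s, `|step_bump A s| <= B)
  (bC2 : forall s, `|'D_1 (step_bump A) s| <= C2)
  (bC3 : forall s, `|'D_1 ('D_1 ('D_1 (step_bump A))) s| <= C3).
Local Notation sb := (space_bump A).
Local Notation rho := (plateau A h).

(** The integral runs over all of space-time, so that means at different centres have a common
    domain; at admissible centres the kernel vanishes outside the cylinder. *)
Definition pressure_mean (y : 'rV[R]_n) (t : R) : R :=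
  \int[mu]_z (w z `^ m * (prod_kernel (sb y) z.1 * rho t z.2)).

Variables (y : 'rV[R]_n) (t u d : R).
Hypotheses (yU : forall x : 'rV[R]_n, (forall i, `|x ord0 i - y ord0 i| <= 3 * e) -> U x)
  (u0 : 0 < u) (ue : u <= e) (u1 : u <= 1) (st1 : s1 < t - u - h - e) (tes2 : t + e < s2).

(** The bump reaches e from its centre, hence 2 e from y after a shift by u <= e. Radius 3 e leaves
    a strict margin, and one slab serves y and all its shifts. *)
Local Notation D := (slab y (3 * e) s1 s2).

Let r0 : 0 < 3 * e. Proof. by rewrite mulr_gt0. Qed.
Let er : 2 * e < 3 * e. Proof. by rewrite ltr_pM2r// ltr_nat. Qed.
Let yin : compactly_inside (ball y (3 * e)) U.
Proof. exact: compactly_inside_ball. Qed.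
Let DU : D `<=` cylinder U t1 t2.
Proof.
by apply: slab_sub_cylinder => //; apply: subset_trans yin.2; exact: subset_closure.
Qed.
Let mD : measurable D. Proof. exact: measurable_slab. Qed.
Let Dy : (mu D < +oo)%E. Proof. exact: slab_lty. Qed.
Let mw : measurable_fun D w.
Proof. by have [] := subsolution_measurable m0 sub r0 yin ts1 s12 st2. Qed.
Let mF : measurable_fun D (fun z => w z `^ m).
Proof. by have [] := subsolution_measurable m0 sub r0 yin ts1 s12 st2. Qed.
Let w_ge0 z : D z -> 0 <= w z.
Proof. by move=> /DU zU; have [w0 _] := sub; have := w0 _ zU; rewrite lee_fin. Qed.
Let wDW z : D z -> w z <= W. Proof. by move=> /DU; exact: wW. Qed.
Let F_ge0 z : D z -> 0 <= w z `^ m. Proof. by move=> _; exact: powR_ge0. Qed.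
Let FW z : D z -> w z `^ m <= W `^ m.
Proof.
move=> Dz; apply: ge0_ler_powR; rewrite ?nnegrE ?(ltW m0) ?w_ge0//.
  by apply: le_trans (wDW Dz); exact: w_ge0.
exact: wDW.
Qed.

Let shifted_support (y' : 'rV[R]_n) : (forall j, `|y' ord0 j - y ord0 j| <= e) ->
  forall j s, 2 * e < `|s - y ord0 j| -> sb y' j s = 0.
Proof.
move=> yy' j s es; apply: (space_bump_eq0 A0 A1).
have := ler_normD (s - y' ord0 j) (y' ord0 j - y ord0 j).
by rewrite addrA subrK; have := yy' j; lra.
Qed.

Let kernel (y' : 'rV[R]_n) (t' : R) (z : 'rV[R]_n * measurableTypeR R) : R :=
  prod_kernel (sb y') z.1 * rho t' z.2.

Let rho_norm t' s : `|rho t' s| <= 1.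
Proof. by rewrite ger0_norm ?(plateau_ge0 e0 eh hA)// (plateau_le1 h hA A0 A1). Qed.

Let kernel_bm (y' : 'rV[R]_n) (t' : R) : (forall j, `|y' ord0 j - y ord0 j| <= e) ->
  bounded_measurable (kernel y' t').
Proof.
move=> yy'; apply: (bounded_measurable_kernel (c := y) (e := 2 * e) (Ck := 1)).
- by move=> j; exact: elem_smooth_space_bump.
- exact: shifted_support.
- exact: elem_smooth_plateau.
- exact: rho_norm.
Qed.

Let kernel_outside (y' : 'rV[R]_n) (t' : R) (z : 'rV[R]_n * measurableTypeR R) :
  (forall j, `|y' ord0 j - y ord0 j| <= e) ->
  s1 < t' - h - e -> t' + e < s2 -> ~ D z -> kernel y' t' z = 0.
Proof.
move=> yy' st' tes' nD; rewrite /kernel.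
have [zb|nzb] := pselect (closed_box y (2 * e) z.1); last first.
  by rewrite (prod_kernel_outside (shifted_support yy') nzb) mul0r.
rewrite (plateau_eq0 e0 eh A0 A1) ?mulr0//.
have [H|H] := ltP z.2 (t' - h - e); first by left.
have [H'|H'] := ltP (t' + e) z.2; first by right.
exfalso; apply: nD; split; first exact: (box_sub_ball r0 er).
by rewrite /= in_itv /=; apply/andP; split; [exact: lt_le_trans st' H|exact: le_lt_trans H' tes'].
Qed.

Let pressure_mean_slab (y' : 'rV[R]_n) (t' : R) : (forall j, `|y' ord0 j - y ord0 j| <= e) ->
  s1 < t' - h - e -> t' + e < s2 ->
  pressure_mean y' t' = \int[mu]_(z in D) (w z `^ m * kernel y' t' z).
Proof.
move=> yy' st' tes'; apply: (@Rintegral_support _ _ _ mu D) => z nD.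
by rewrite -/(kernel y' t' z) kernel_outside ?mulr0.
Qed.

Let yy j : `|y ord0 j - y ord0 j| <= e.
Proof. by rewrite subrr normr0 ltW. Qed.

Let st : s1 < t - h - e.
Proof. by move: (st1) (u0) => ? ?; lra. Qed.

Let Dmeas : fine (mu D) <= (2 * (3 * e)) ^+ n * (s2 - s1).
Proof. exact: slab_measure_le. Qed.

Let vol := (2 * (3 * e)) ^+ n * (s2 - s1).

Let C3_ge0 : 0 <= C3. Proof. exact: le_trans (normr_ge0 _) (bC3 0). Qed.

Let laplace_factor i (z : 'rV[R]_n * measurableTypeR R) : R :=
  prod_kernel (derive_factor (derive_factor (sb y) i) i) z.1 * rho t z.2.

Let laplace_bm i : bounded_measurable (laplace_factor i).
Proof.
apply: (bounded_measurable_kernel (c := y) (e := 2 * e) (Ck := 1)).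
- by do 2 apply: elem_smooth_derive_factor; move=> j; exact: elem_smooth_space_bump.
- by do 2 apply: derive_factor_eq0; exact: shifted_support.
- exact: elem_smooth_plateau.
- exact: rho_norm.
Qed.

(** The kernel u^2 times the second derivative, plus twice the centred kernel, minus the two shifted
    ones, is pointwise O(u^3). Integrated against F >= 0, it bounds the second derivative of the
    mean by its second difference, which the approximate maximum controls. *)
Lemma space_step i :
  pressure_mean (u *: delta_mx ord0 i + y) t <= pressure_mean y t + u ^+ 3 ->
  pressure_mean ((- u) *: delta_mx ord0 i + y) t <= pressure_mean y t + u ^+ 3 ->
  \int[mu]_(z in D) (w z `^ m * laplace_factor i z) <=
    (2 + W `^ m * (B ^+ n * (3 * C3)) * vol) * u.
Proof.
have sh v j : `|v| <= e -> `|(v *: delta_mx ord0 i + y) ord0 j - y ord0 j| <= e.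
  move=> ve; rewrite !mxE addrK; case: (j == i); rewrite ?andbF/= ?mulr1//.
  by rewrite mulr0 normr0 ltW.
have up : `|u| <= e by rewrite ger0_norm// ltW.
have um : `|- u| <= e by rewrite normrN.
have hp j := sh _ j up; have hm j := sh _ j um.
rewrite !pressure_mean_slab//.
set yp := u *: _ + y; set ym := (- u) *: _ + y.
have bp : bounded_measurable (kernel yp t) by exact: kernel_bm.
have bm : bounded_measurable (kernel ym t) by exact: kernel_bm.
have b0 : bounded_measurable (kernel y t) by exact: kernel_bm.
have bl := laplace_bm i.
pose c : R := B ^+ n * (3 * C3) * u ^+ 3.
have c0 : 0 <= c.
  apply: mulr_ge0; last by apply: exprn_ge0; exact: ltW.
  apply: mulr_ge0; last by apply: mulr_ge0 => //; exact: C3_ge0.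
  by apply: exprn_ge0; exact: le_trans B1.
pose K z := u ^+ 2 * laplace_factor i z +
   (2 * kernel y t z + (-1 * kernel yp t z + -1 * kernel ym t z)).
have b1 := bounded_measurableD (bounded_measurableZ (-1) bp) (bounded_measurableZ (-1) bm).
have b2 := bounded_measurableD (bounded_measurableZ 2 b0) b1.
have bK : bounded_measurable K := bounded_measurableD (bounded_measurableZ (u ^+ 2) bl) b2.
have Kc z : D z -> K z <= c.
  move=> _; have H := prod_kernel_second_difference sA y z.1 i (ltW u0) B1 bB bC3.
  rewrite mulrA in H; apply: second_difference_kernel_le H.
  by rewrite (plateau_ge0 e0 eh hA) (plateau_le1 h hA A0 A1).
have H := weighted_le_cst mD Dy mF F_ge0 FW bK c0 Kc.
move=> h1 h2; apply: (space_step_arith u0 _ Dmeas h1 h2).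
  by rewrite !mulr_ge0 ?powR_ge0 ?exprn_ge0// (le_trans ler01).
apply: le_trans H; rewrite /K.
rewrite (weightedD mD Dy mF F_ge0 FW (bounded_measurableZ (u ^+ 2) bl) b2).
rewrite (weightedD mD Dy mF F_ge0 FW (bounded_measurableZ 2 b0) b1).
rewrite (weightedD mD Dy mF F_ge0 FW (bounded_measurableZ (-1) bp) (bounded_measurableZ (-1) bm)).
rewrite (weightedZ mD Dy mF F_ge0 FW (u ^+ 2) bl) (weightedZ mD Dy mF F_ge0 FW 2 b0).
by rewrite (weightedZ mD Dy mF F_ge0 FW (-1) bp) (weightedZ mD Dy mF F_ge0 FW (-1) bm).
Qed.

Let flux (z : 'rV[R]_n * measurableTypeR R) : R :=
  prod_kernel (sb y) z.1 * 'D_1 (rho t) z.2.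

Let bump_bm (c : R) :
  bounded_measurable (fun z : 'rV[R]_n * measurableTypeR R =>
    prod_kernel (sb y) z.1 * step_bump A (z.2 - c)).
Proof.
apply: (bounded_measurable_kernel (c := y) (e := 2 * e) (Ck := B)
   (k := fun s => step_bump A (s - c))).
- by move=> j; exact: elem_smooth_space_bump.
- exact: shifted_support.
- exact: (elem_smooth_shift c (elem_smooth_bump sA)).
- by move=> s; exact: bB.
Qed.

Let fluxE z : flux z = prod_kernel (sb y) z.1 * step_bump A (z.2 - (t - h)) +
  -1 * (prod_kernel (sb y) z.1 * step_bump A (z.2 - t)).
Proof. by rewrite /flux derive_plateau// mulrBr mulN1r. Qed.

Let flux_bm : bounded_measurable flux.
Proof.
rewrite (_ : flux = fun z => prod_kernel (sb y) z.1 * step_bump A (z.2 - (t - h)) +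
  -1 * (prod_kernel (sb y) z.1 * step_bump A (z.2 - t))).
  exact: (bounded_measurableD (bump_bm (t - h)) (bounded_measurableZ (-1) (bump_bm t))).
by apply/funext => z; exact: fluxE.
Qed.

Let prod_kernel_le x : `|prod_kernel (sb y) x| <= B ^+ n.
Proof.
rewrite /prod_kernel normr_prod.
have -> : B ^+ n = \prod_(j < n) B by rewrite prodr_const card_ord.
by apply: ler_prod => j _; rewrite normr_ge0 bB.
Qed.

(** The same device with a first difference: up to O(u^2), the mean at t - u exceeds the mean at t
    by u times the flux of F, while the penalised maximum makes it smaller by d u up to u^3. *)
Lemma time_step :
  pressure_mean y (t - u) + d * u <= pressure_mean y t + u ^+ 3 ->
  \int[mu]_(z in D) (w z `^ m * flux z) <=
    - d + (1 + W `^ m * (B ^+ n * (2 * C2)) * vol) * u.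
Proof.
have st' : s1 < (t - u) - h - e := st1.
have te' : (t - u) + e < s2 by move: (u0) (tes2) => ? ?; lra.
rewrite !pressure_mean_slab//.
have b0 : bounded_measurable (kernel y t) by exact: kernel_bm.
have b1 : bounded_measurable (kernel y (t - u)) by exact: kernel_bm.
have C20 : 0 <= C2 := le_trans (normr_ge0 _) (bC2 0).
have Bn0 : 0 <= B ^+ n by rewrite exprn_ge0// (le_trans ler01).
pose c : R := B ^+ n * (2 * C2) * u ^+ 2.
have C2u : 0 <= 2 * C2 * u ^+ 2.
  by apply: mulr_ge0; [exact: mulr_ge0|exact: sqr_ge0].
have c0 : 0 <= c by rewrite /c -mulrA; exact: mulr_ge0.
pose K z := u * flux z + (kernel y t z + -1 * kernel y (t - u) z).
have b2 := bounded_measurableD b0 (bounded_measurableZ (-1) b1).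
have bK : bounded_measurable K := bounded_measurableD (bounded_measurableZ u flux_bm) b2.
have D2 s : `|'D_1 ('D_1 (rho t)) s| <= 2 * C2.
  rewrite derive2_plateau//; apply: le_trans (ler_normB _ _) _.
  by rewrite mulr_natl mulr2n lerD.
have Kc z : D z -> K z <= c.
  move=> _; rewrite /K /flux /kernel /c plateau_shift -mulrA.
    apply: (first_difference_kernel_le C2u (prod_kernel_le z.1)).
  exact: (first_difference z.2 (elem_smooth_plateau h sA t) (ltW u0) D2).
have H := weighted_le_cst mD Dy mF F_ge0 FW bK c0 Kc.
move=> h1; apply: (time_step_arith u0 u1 _ Dmeas h1).
  by apply: mulr_ge0; [exact: powR_ge0|apply: mulr_ge0 => //; exact: mulr_ge0].
apply: le_trans H; rewrite /K.
rewrite (weightedD mD Dy mF F_ge0 FW (bounded_measurableZ u flux_bm) b2).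
rewrite (weightedD mD Dy mF F_ge0 FW b0 (bounded_measurableZ (-1) b1)).
by rewrite (weightedZ mD Dy mF F_ge0 FW u flux_bm) (weightedZ mD Dy mF F_ge0 FW (-1) b1).
Qed.

(** The weak inequality says that the flux of w plus the n second derivatives of the mean of F is
    nonnegative. *)
Lemma weak_step (c : R) :
  (forall i, \int[mu]_(z in D) (w z `^ m * laplace_factor i z) <= c) ->
  - (c *+ n) <= \int[mu]_(z in D) (w z * flux z).
Proof.
move=> Hc.
have := @weak_subsolution_kernel R n U t1 t2 m w y (3 * e) e s1 s2 (t - h - e) (t + e)
  (sb y) (rho t) W m0 sub wW r0 _ yin ts1 st s12 tes2 st2.
have e3 : e < 3 * e by move: (e0) => ?; lra.
move=> /(_ e3 (fun j => elem_smooth_space_bump sA y j)).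
move=> /(_ (fun j s => @space_bump_eq0 _ _ _ _ A0 A1 y j s)).
move=> /(_ (fun j s => space_bump_ge0 sA hA y j s) (elem_smooth_plateau h sA t)).
move=> /(_ (fun s => @plateau_eq0 _ _ _ _ e0 eh A0 A1 t s) (plateau_ge0 e0 eh hA t)).
move=> H; rewrite -subr_ge0 opprK; apply: le_trans H _.
rewrite lerD2l.
apply: le_trans (ler_sum (G := fun=> c) _ _) _ => [i _|]; first exact: Hc.
by rewrite sumr_const card_ord.
Qed.

Let bump_mass_slab (c : R) : s1 < c - e -> c + e < s2 ->
  \int[mu]_(z in D) (prod_kernel (sb y) z.1 * step_bump A (z.2 - c)) = 1.
Proof.
move=> sc cs; rewrite -Rintegral_support.
  by rewrite /Rintegral (bump_mass e0 sA hA A0 A1).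
move=> z nD.
have [zb|nzb] := pselect (closed_box y (2 * e) z.1); last first.
  by rewrite (prod_kernel_outside (shifted_support yy) nzb) mul0r.
rewrite (bump_eq0 A0 A1) ?mulr0// ltNge; apply/negP; rewrite ler_distl => /andP[h1 h2].
apply: nD; split; first exact: (box_sub_ball r0 er).
by rewrite /= in_itv /=; apply/andP; split; [exact: lt_le_trans sc h1|exact: le_lt_trans h2 cs].
Qed.

Let near_center (c : R) z : prod_kernel (sb y) z.1 * step_bump A (z.2 - c) != 0 ->
  (forall j, `|z.1 ord0 j - y ord0 j| <= e) /\ `|z.2 - c| <= e.
Proof.
move=> nz; split; last first.
  rewrite leNgt; apply/negP => H; move: nz.
  by rewrite (bump_eq0 A0 A1) ?mulr0 ?eqxx.
move=> j; rewrite leNgt; apply/negP => H; move: nz.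
rewrite (prod_kernel_outside (c := y) (e := e)) ?mul0r ?eqxx//.
  by move=> i s; exact: space_bump_eq0.
by move=> /(_ j); rewrite leNgt H.
Qed.

Let bump_kernel_ge0 (c : R) z : 0 <= prod_kernel (sb y) z.1 * step_bump A (z.2 - c).
Proof. by rewrite mulr_ge0 ?bump_ge0// prod_space_bump_ge0. Qed.

Section flux_mean.
Variables (f : 'rV[R]_n * R -> R) (Cf : R).
Hypotheses (mf : measurable_fun D f) (f0 : forall z, D z -> 0 <= f z)
  (fC : forall z, D z -> f z <= Cf).

Let flux_split : \int[mu]_(z in D) (f z * flux z) =
  \int[mu]_(z in D) (f z * (prod_kernel (sb y) z.1 * step_bump A (z.2 - (t - h)))) -
  \int[mu]_(z in D) (f z * (prod_kernel (sb y) z.1 * step_bump A (z.2 - t))).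
Proof.
transitivity (\int[mu]_(z in D) (f z * (prod_kernel (sb y) z.1 * step_bump A (z.2 - (t - h)) +
    -1 * (prod_kernel (sb y) z.1 * step_bump A (z.2 - t))))).
  by apply: eq_Rintegral => z _; rewrite fluxE.
apply: etrans (weightedD mD Dy mf f0 fC (bump_bm (t - h))
  (bounded_measurableZ (-1) (bump_bm t))) _.
congr (_ + _); apply: etrans (weightedZ mD Dy mf f0 fC (-1) (bump_bm t)) _.
exact: mulN1r.
Qed.

Let sth : s1 < t - h - e /\ (t - h) + e < s2 /\ s1 < t - e.
Proof. by move: (st) (tes2) (e0) (eh) => ? ? ? ?; split; [|split]; lra. Qed.

Let bump_kernel (c : R) (z : 'rV[R]_n * measurableTypeR R) : R :=
  prod_kernel (sb y) z.1 * step_bump A (z.2 - c).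

Let bump_mean_ge (c a : R) : s1 < c - e -> c + e < s2 ->
  (forall z : 'rV[R]_n * R, (forall j, `|z.1 ord0 j - y ord0 j| <= e) ->
    `|z.2 - c| <= e -> a <= f z) ->
  a <= \int[mu]_(z in D) (f z * bump_kernel c z).
Proof.
move=> sc cs fa; rewrite -[a]mulr1 -[X in a * X](bump_mass_slab sc cs).
apply: (@Rintegral_kernel_ge _ _ _ mu D f (bump_kernel c) a mD) => //.
- exact: (bounded_measurable_integrable mD Dy (bump_bm c)).
- exact: (weighted_integrable mD Dy mf f0 fC (bump_bm c)).
- by move=> z _; exact: bump_kernel_ge0.
- by move=> z _ /near_center [p1 p2]; exact: fa.
Qed.

Let bump_mean_le (c a : R) : s1 < c - e -> c + e < s2 ->
  (forall z : 'rV[R]_n * R, (forall j, `|z.1 ord0 j - y ord0 j| <= e) ->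
    `|z.2 - c| <= e -> f z <= a) ->
  \int[mu]_(z in D) (f z * bump_kernel c z) <= a.
Proof.
move=> sc cs fa; rewrite -[a]mulr1 -[X in a * X](bump_mass_slab sc cs).
apply: (@Rintegral_kernel_le _ _ _ mu D f (bump_kernel c) a mD) => //.
- exact: (bounded_measurable_integrable mD Dy (bump_bm c)).
- exact: (weighted_integrable mD Dy mf f0 fC (bump_bm c)).
- by move=> z _; exact: bump_kernel_ge0.
- by move=> z _ /near_center [p1 p2]; exact: fa.
Qed.

(** Both bumps have mass one in the slab, so the flux is an average of f near (y, t - h) minus an
    average near (y, t). The lower bound serves f = w^m, the upper bound [flux_le] serves f = w. *)
Lemma flux_ge (a1 a2 : R) :
  (forall z : 'rV[R]_n * R, (forall j, `|z.1 ord0 j - y ord0 j| <= e) ->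
    `|z.2 - (t - h)| <= e -> a1 <= f z) ->
  (forall z : 'rV[R]_n * R, (forall j, `|z.1 ord0 j - y ord0 j| <= e) ->
    `|z.2 - t| <= e -> f z <= a2) ->
  a1 - a2 <= \int[mu]_(z in D) (f z * flux z).
Proof.
move=> h1 h2; rewrite flux_split; have [H1 [H2 H3]] := sth.
apply: lerB; first exact: bump_mean_ge.
exact: bump_mean_le.
Qed.

Lemma flux_le (a1 a2 : R) :
  (forall z : 'rV[R]_n * R, (forall j, `|z.1 ord0 j - y ord0 j| <= e) ->
    `|z.2 - (t - h)| <= e -> f z <= a1) ->
  (forall z : 'rV[R]_n * R, (forall j, `|z.1 ord0 j - y ord0 j| <= e) ->
    `|z.2 - t| <= e -> a2 <= f z) ->
  \int[mu]_(z in D) (f z * flux z) <= a1 - a2.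
Proof.
move=> h1 h2; rewrite flux_split; have [H1 [H2 H3]] := sth.
apply: lerB; first exact: bump_mean_le.
exact: bump_mean_ge.
Qed.

End flux_mean.

Lemma near_maximum_comparison (a1 a2 b1 b2 : R) :
  (forall i, pressure_mean (u *: delta_mx ord0 i + y) t <= pressure_mean y t + u ^+ 3) ->
  (forall i, pressure_mean ((- u) *: delta_mx ord0 i + y) t <= pressure_mean y t + u ^+ 3) ->
  pressure_mean y (t - u) + d * u <= pressure_mean y t + u ^+ 3 ->
  (forall z : 'rV[R]_n * R, (forall j, `|z.1 ord0 j - y ord0 j| <= e) ->
    `|z.2 - (t - h)| <= e -> a1 <= w z `^ m /\ w z <= b1) ->
  (forall z : 'rV[R]_n * R, (forall j, `|z.1 ord0 j - y ord0 j| <= e) ->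
    `|z.2 - t| <= e -> w z `^ m <= a2 /\ b2 <= w z) ->
  a1 - a2 <= - d + (1 + W `^ m * (B ^+ n * (2 * C2)) * vol) * u /\
  - (((2 + W `^ m * (B ^+ n * (3 * C3)) * vol) * u) *+ n) <= b1 - b2.
Proof.
move=> hp hm ht h1 h2; split.
  apply: le_trans (time_step ht).
  by apply: (flux_ge mF F_ge0 FW) => z zy zt; [have [] := h1 z zy zt|have [] := h2 z zy zt].
apply: le_trans (weak_step (fun i => space_step (hp i) (hm i))) _.
by apply: (flux_le mw w_ge0 wDW) => z zy zt; [have [] := h1 z zy zt|have [] := h2 z zy zt].
Qed.

Let kernel_ge0 z : 0 <= kernel y t z.
Proof. by rewrite mulr_ge0 ?(plateau_ge0 e0 eh hA)// prod_space_bump_ge0. Qed.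

Let kernel_mass_bounds : h - 2 * e <= \int[mu]_(z in D) kernel y t z <= h + 2 * e.
Proof.
rewrite -Rintegral_support; last by move=> z; exact: kernel_outside.
have H1 := plateau_mass_le e0 eh sA hA A0 A1 y t.
have H2 := plateau_mass_ge e0 eh sA hA A0 A1 y t.
rewrite /Rintegral -!lee_fin fineK; first by rewrite H1 H2.
rewrite ge0_fin_numE; last by apply: integral_ge0 => z _; rewrite lee_fin kernel_ge0.
by apply: le_lt_trans H1 _; exact: ltry.
Qed.

Let kernel_near z : kernel y t z != 0 ->
  (forall j, `|z.1 ord0 j - y ord0 j| <= e) /\ t - h - e <= z.2 <= t + e.
Proof.
move=> nz; split.
  move=> j; rewrite leNgt; apply/negP => H; move: nz.
  rewrite /kernel (prod_kernel_outside (c := y) (e := e)) ?mul0r ?eqxx//.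
    by move=> i s; exact: space_bump_eq0.
  by move=> /(_ j); rewrite leNgt H.
apply/andP; split; rewrite leNgt; apply/negP => H; move: nz;
  rewrite /kernel (plateau_eq0 e0 eh A0 A1) ?mulr0 ?eqxx//; [by left|by right].
Qed.

(** Used in contrapositive: a large mean forces a point with large w in the support of the
    kernel. *)
Lemma pressure_mean_le (c : R) : 0 <= c ->
  (forall z : 'rV[R]_n * R, (forall j, `|z.1 ord0 j - y ord0 j| <= e) ->
    t - h - e <= z.2 <= t + e -> w z `^ m <= c) ->
  pressure_mean y t <= c * (h + 2 * e).
Proof.
move=> c0 wc; rewrite pressure_mean_slab//.
have /andP[_ H] := kernel_mass_bounds; apply: le_trans (ler_wpM2l c0 H).
apply: (@Rintegral_kernel_le _ _ _ mu D (fun z => w z `^ m) (kernel y t) c mD) => //.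
- exact: (bounded_measurable_integrable mD Dy (kernel_bm _ yy)).
- exact: (weighted_integrable mD Dy mF F_ge0 FW (kernel_bm _ yy)).
- by move=> z _ /kernel_near [p1 p2]; exact: wc.
Qed.

Lemma pressure_mean_ge (c : R) : 0 <= c ->
  (forall z : 'rV[R]_n * R, (forall j, `|z.1 ord0 j - y ord0 j| <= e) ->
    t - h - e <= z.2 <= t + e -> c <= w z `^ m) ->
  c * (h - 2 * e) <= pressure_mean y t.
Proof.
move=> c0 wc; rewrite pressure_mean_slab//.
have /andP[H _] := kernel_mass_bounds; apply: le_trans (ler_wpM2l c0 H) _.
apply: (@Rintegral_kernel_ge _ _ _ mu D (fun z => w z `^ m) (kernel y t) c mD) => //.
- exact: (bounded_measurable_integrable mD Dy (kernel_bm _ yy)).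
- exact: (weighted_integrable mD Dy mF F_ge0 FW (kernel_bm _ yy)).
- by move=> z _ /kernel_near [p1 p2]; exact: wc.
Qed.

End near_maximum.

(** * The maximum principle *)

Section max_principle.
Context {R : realType}.

Lemma smooth_step_bounds (e : R) : 0 < e -> exists (A : R -> R) (B C2 C3 : R),
  [/\ elem_smooth A, {homo A : s t / s <= t},
      forall s, s <= - e -> A s = 0, forall s, e <= s -> A s = 1 & 1 <= B] /\
  [/\ forall s, `|step_bump A s| <= B, forall s, `|'D_1 (step_bump A) s| <= C2 &
      forall s, `|'D_1 ('D_1 ('D_1 (step_bump A))) s| <= C3].
Proof.
move=> e0; have [A [sA hA A0 A1]] := smooth_step e0.
have s0 := elem_smooth_bump sA.
have z0 := fun s => @bump_eq0 _ _ _ A0 A1 s.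
have s1 := @elem_smooth_derive R R^o _ 1 s0.
have z1 : forall s, e < `|s| -> 'D_1 (step_bump A) s = 0.
  by move=> s; exact: (derive_eq0_outside z0).
have s2 := @elem_smooth_derive R R^o _ 1 s1.
have z2 : forall s, e < `|s| -> 'D_1 ('D_1 (step_bump A)) s = 0.
  by move=> s; exact: (derive_eq0_outside z1).
have s3 := @elem_smooth_derive R R^o _ 1 s2.
have z3 : forall s, e < `|s| -> 'D_1 ('D_1 ('D_1 (step_bump A))) s = 0.
  by move=> s; exact: (derive_eq0_outside z2).
have [B B0 HB] := elem_smooth_bounded s0 z0.
have [C2 _ H2] := elem_smooth_bounded s1 z1.
have [C3 _ H3] := elem_smooth_bounded s3 z3.
(* The bound is raised to at least 1, so that its n-th power also bounds products of fewer
   factors. *)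
exists A, (1 + B), C2, C3; split; split => //; first by rewrite lerDl.
by move=> s; apply: le_trans (HB s) _; rewrite lerDr.
Qed.

Lemma near_sup (T : Type) (E : set T) (f : T -> R) (C u : R) :
  E !=set0 -> (forall p, E p -> f p <= C) -> 0 < u ->
  exists2 p, E p & forall q, E q -> f q <= f p + u.
Proof.
move=> [p0 Ep0] fC u0.
have hs : has_sup (f @` E).
  split; first by exists (f p0), p0.
  by exists C => _ [p Ep <-]; exact: fC.
have [_ [p Ep <-] Hp] := sup_adherent u0 hs.
exists p => // q Eq; rewrite -lerBlDr; apply/ltW/(le_lt_trans _ Hp).
rewrite lerD2r; apply: (ub_le_sup hs.2); by exists q.
Qed.

Lemma exists_small3 (a b c : R) : 0 < a -> 0 < b -> 0 < c ->
  exists2 x, 0 < x & [/\ x <= a, x <= b & x <= c].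
Proof.
move=> a0 b0 c0; exists (Num.min a (Num.min b c)); first by rewrite !lt_min a0 b0 c0.
by split; rewrite ?ge_min ?lexx ?orbT.
Qed.

Context {n : nat}.
Variables (U : set 'rV[R]_n) (t1 t2 m M : R) (w : 'rV[R]_n * R -> R).

Lemma closure_cylinder (z : 'rV[R]_n * R) : closure (cylinder U t1 t2) z ->
  closure U z.1 /\ t1 <= z.2 <= t2.
Proof.
have cl : closed ([set z : 'rV[R]_n * R | closure U z.1] `&` [set z | `[t1, t2]%classic z.2]).
  apply: closedI.
    apply: (@closed_comp _ _ fst (closure U)); last exact: closed_closure.
    by move=> x _; exact: cvg_fst.
  apply: (@closed_comp _ _ snd `[t1, t2]%classic); last exact: itv_closed.
  by move=> x _; exact: cvg_snd.
move=> Hz; suff [H1 H2] : ([set z : 'rV[R]_n * R | closure U z.1] `&`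
    [set z | `[t1, t2]%classic z.2]) z by split; [exact: H1|move: H2; rewrite /= in_itv].
rewrite (proj1 (closure_id _) cl); apply: closureS Hz => x [x1 x2].
split; first exact: subset_closure.
by move: x2; rewrite /= !in_itv /= => /andP[p q]; rewrite !ltW.
Qed.

(** The hypotheses give d <= 4 L o + (Ct + n L Cs) u, whose two terms are at most d / 2 and d /
    4. *)
Lemma comparison_contradiction (d L o u Ct Cs F1 F2 w1 w2 : R) :
  0 < d -> 0 <= L -> 0 <= o -> 0 <= u -> 0 <= Cs -> 8 * (L * o) <= d ->
  4 * ((Ct + L * (Cs *+ n)) * u) <= d ->
  (w1 <= w2 -> F2 - F1 <= L * (w2 - w1)) -> (w2 <= w1 -> F2 <= F1) ->
  (F1 - L * o) - (F2 + L * o) <= - d + Ct * u ->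
  - ((Cs * u) *+ n) <= (w1 + o) - (w2 - o) -> False.
Proof.
move=> d0 L0 o0 u0 Cs0 Ho Hu Hl Hm HF Hw.
have CsE : (Cs * u) *+ n = (Cs *+ n) * u by rewrite -mulrnAl.
have Cn0 : 0 <= Cs *+ n by rewrite mulrn_wge0.
rewrite CsE in Hw.
have key : F2 - F1 <= L * (2 * o + (Cs *+ n) * u).
  have [H|H] := leP w1 w2.
    apply: le_trans (Hl H) _; rewrite ler_wpM2l//; lra.
  have := Hm (ltW H) => h.
  by apply: (@le_trans _ _ 0); [lra|rewrite mulr_ge0// addr_ge0 ?mulr_ge0].
have : L * (2 * o + (Cs *+ n) * u) = 2 * (L * o) + L * (Cs *+ n) * u by ring.
have : (Ct + L * (Cs *+ n)) * u = Ct * u + L * (Cs *+ n) * u by ring.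
move: (L * o) (Ct * u) (L * (Cs *+ n) * u) Ho Hu key HF => a b c.
move=> Ho Hu key HF E1 E2; lra.
Qed.

(** The gain (K2 - K1) h would be at most 2 e (K1 + K2) + d (t0 - t) + u, that is, at most 1/8 + 1/4
    + 1/4 of itself. *)
Lemma mean_contradiction (P0 P1 K1 K2 h e d t0 t u : R) :
  0 < K2 - K1 -> 0 < h -> 16 * (e * (K1 + K2)) <= (K2 - K1) * h ->
  4 * (d * (t0 - t)) <= (K2 - K1) * h -> 4 * u <= (K2 - K1) * h ->
  K2 * (h - 2 * e) <= P0 -> P1 <= K1 * (h + 2 * e) ->
  P0 - d * t0 <= P1 - d * t + u -> False.
Proof.
move=> G0 h0 He Hd Hu H0 H1 H.
have Gh : 0 < (K2 - K1) * h by rewrite mulr_gt0.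
nra.
Qed.

Hypotheses (oU : open U) (m1 : 1 < m) (M0 : 0 <= M) (t12 : t1 < t2)
  (cQ : compact (closure (cylinder U t1 t2)))
  (cw : {within closure (cylinder U t1 t2), continuous w})
  (sub : weak_subsolution m U t1 t2 (EFin \o w))
  (wM : forall z, parabolic_boundary U t1 t2 z -> w z <= M).

Local Notation Q := (closure (cylinder U t1 t2)).

Let m0 : 0 < m. Proof. exact: lt_trans m1. Qed.

(** Apart from the lid at time t2, the closure consists of the cylinder and its parabolic boundary,
    where w <= M. *)
Lemma superlevel_interior (z : 'rV[R]_n * R) : Q z -> z.2 < t2 -> M < w z ->
  cylinder U t1 t2 z.
Proof.
move=> Qz zt2 Mz; have [zU /andP[zt1 _]] := closure_cylinder Qz.
have nP : ~ parabolic_boundary U t1 t2 z.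
  by move=> /wM; rewrite leNgt Mz.
move: zt1; rewrite le_eqVlt => /predU1P[zt1|zt1].
  by exfalso; apply: nP; right; split.
have zI : `]t1, t2[%classic z.2 by rewrite /= in_itv /= zt1 zt2.
split => //; apply: contrapT => nU; apply: nP; left; split => //; split => //.
by move=> /interior_subset.
Qed.

(** Up to time T < t2 the set where w >= c is compact and lies in the open cylinder, hence at a
    positive distance from the complement. *)
Lemma superlevel_room (c T : R) : M < c -> T < t2 -> exists2 r, 0 < r &
  forall z, Q z -> z.2 <= T -> c <= w z ->
    (forall x : 'rV[R]_n, (forall i, `|x ord0 i - z.1 ord0 i| < r) -> U x) /\ t1 + r <= z.2.
Proof.
move=> Mc Tt2.
pose H := [set z : 'rV[R]_n * R | z.2 <= T].
have cH : closed H.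
  apply: (@closed_comp _ _ snd [set s : R | s <= T]); last exact: closed_le.
  by move=> x _; exact: cvg_snd.
have cQH : compact (Q `&` H) by apply: compact_closedI.
have cwH : {within Q `&` H, continuous w}.
  by apply: continuous_subspaceW cw; exact: subIsetl.
have oC : open (cylinder U t1 t2).
  apply: (@openI _ (fst @^-1` U) (snd @^-1` `]t1, t2[%classic)).
    by apply: open_comp => // x _; exact: cvg_fst.
  by apply: open_comp; [move=> x _; exact: cvg_snd|exact: itv_open].
have [r r0 Hr] := compact_superlevel_ball cQH cwH oC (c := c) (fun z QHz cz =>
  superlevel_interior QHz.1 (le_lt_trans QHz.2 Tt2) (lt_le_trans Mc cz)).
exists (r / 2); first by rewrite divr_gt0.
move=> z Qz zT cz; have {}Hr := Hr z (conj Qz zT) cz; split.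
  move=> x xz; have : cylinder U t1 t2 (x, z.2).
    apply: Hr; split; last exact: ballxx.
    apply/ball_rVE; split => // i; rewrite distrC.
    by apply: lt_le_trans (xz i) _; rewrite ler_pdivrMr// ler_pMr// ler1n.
  by case.
have : cylinder U t1 t2 (z.1, z.2 - r / 2).
  apply: Hr; split; first exact: ballxx.
  rewrite /ball /= opprB addrC subrK ger0_norm ?divr_ge0 ?ltW//.
  by rewrite ltr_pdivrMr// ltr_pMr// ltr1n.
by move=> [_ /=]; rewrite in_itv /= => /andP[H1 _]; lra.
Qed.

End max_principle.

Lemma subsolution_max_principle {R : realType} {n : nat} (U : set 'rV[R]_n)
    (t1 t2 m M : R) (w : 'rV[R]_n * R -> R) (z : 'rV[R]_n * R) :
  open U -> 1 < m -> 0 <= M -> t1 < t2 ->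
  compact (closure (cylinder U t1 t2)) ->
  {within closure (cylinder U t1 t2), continuous w} ->
  weak_subsolution m U t1 t2 (EFin \o w) ->
  (forall z, parabolic_boundary U t1 t2 z -> w z <= M) ->
  cylinder U t1 t2 z -> w z <= M.
Proof.
set Q := closure (cylinder U t1 t2).
move=> oU m1 M0 t12 cQ cw sub wM.
have m0 : 0 < m by exact: lt_trans m1.
case: z => [x0 t0] z0; rewrite leNgt; apply/negP => Mw.
have sQ : cylinder U t1 t2 `<=` Q by exact: subset_closure.
have t0I : t1 < t0 < t2 by have [_ /=] := z0; rewrite in_itv.
have w_ge0 z : cylinder U t1 t2 z -> 0 <= w z.
  by have [w0 _] := sub; move=> /w0; rewrite lee_fin.
have [W W0 wW] := within_continuous_bounded cQ cw.
have {}wW z : cylinder U t1 t2 z -> w z <= W by move=> /sQ; exact: wW.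
(* Two levels that divide [M, w0] into thirds: w >= M2 near (x0, t0), while points with w >= M1 keep
   away from the parabolic boundary. The gap between M1^m and M2^m drives the argument. *)
pose w0 := w (x0, t0); pose M1 := (2 * M + w0) / 3; pose M2 := (M + 2 * w0) / 3.
have [MM1 M12 M2w] : [/\ M < M1, M1 < M2 & M2 < w0].
  by rewrite /M1 /M2 -/w0 in Mw *; split; lra.
have M10 : 0 <= M1 by rewrite (le_trans M0)// ltW.
have M20 : 0 <= M2 by rewrite (le_trans M10)// ltW.
pose K1 := M1 `^ m; pose K2 := M2 `^ m.
have K12 : 0 < K2 - K1 by rewrite subr_gt0 /K1 /K2 gt0_ltr_powR ?nnegrE.
have K10 : 0 <= K1 by exact: powR_ge0.
have K20 : 0 <= K2 by exact: powR_ge0.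
pose T := (t0 + t2) / 2.
have [t0T Tt2] : t0 < T /\ T < t2 by rewrite /T; move/andP: t0I => [? ?]; split; lra.
have [r r0 Hr] := superlevel_room oU cQ cw wM MM1 Tt2.
have o10 : 0 < w0 - M2 by rewrite subr_gt0.
have [da da0 Hda] := within_continuous_unif cQ cw o10.
have [h h0 [h1 h2 h3]] : exists2 h, 0 < h & [/\ h <= r / 16, h <= da / 4 & h <= (T - t0) / 4].
  by apply: exists_small3; rewrite divr_gt0// subr_gt0.
have Gh0 : 0 < (K2 - K1) * h by rewrite mulr_gt0.
have t120 : 0 < t2 - t1 by rewrite subr_gt0.
(* The penalty accumulated over the whole time span is then a quarter of the gain (K2 - K1) h. *)
pose d := (K2 - K1) * h / (4 * (t2 - t1)).
have d0 : 0 < d by rewrite divr_gt0// mulr_gt0.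
pose L := m * W `^ (m - 1).
have L0 : 0 <= L by rewrite mulr_ge0 ?powR_ge0// ltW.
have L10 : 0 < L + 1 by rewrite ltr_wpDl.
(* Ensures 8 L o <= d; the 1 avoids division by zero, since L may vanish as far as is known here. *)
pose o := d / (8 * (L + 1)).
have o0 : 0 < o by rewrite divr_gt0// mulr_gt0.
have [db db0 Hdb] := within_continuous_unif cQ cw o0.
have K120 : 0 < K1 + K2 + 1 by rewrite ltr_wpDl// addr_ge0.
have [e e0 [e1 e2 e3]] : exists2 e, 0 < e &
    [/\ e <= h / 8, e <= db / 2 & e <= (K2 - K1) * h / (16 * (K1 + K2 + 1))].
  by apply: exists_small3; rewrite divr_gt0// mulr_gt0.
have [A [B [C2 [C3 [[sA hA A0 A1 B1] [bB bC2 bC3]]]]]] := smooth_step_bounds e0.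
pose s1 := t1 + h.
pose vol := (2 * (3 * e)) ^+ n * (T - s1).
pose Ct := 1 + W `^ m * (B ^+ n * (2 * C2)) * vol.
pose Cs := 2 + W `^ m * (B ^+ n * (3 * C3)) * vol.
have s1T : s1 < T.
  have [_] := Hr _ (sQ _ z0) (ltW t0T) (ltW (lt_trans M12 M2w)).
  by rewrite /s1 /=; move: t0T h1 h0; clear; lra.
have C30 : 0 <= C3 := le_trans (normr_ge0 _) (bC3 0).
have vol0 : 0 <= vol.
  apply: mulr_ge0; last by rewrite subr_ge0 ltW.
  by apply: exprn_ge0; apply: mulr_ge0 => //; apply: mulr_ge0 => //; exact: ltW.
have Cs0 : 0 <= Cs.
  apply: addr_ge0 => //; apply: mulr_ge0 => //; apply: mulr_ge0; first exact: powR_ge0.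
  apply: mulr_ge0; last exact: mulr_ge0.
  by apply: exprn_ge0; exact: le_trans ler01 B1.
pose X := `|Ct + L * (Cs *+ n)|.
have X0 : 0 < 4 * (X + 1) by rewrite mulr_gt0// ltr_wpDl// /X normr_ge0.
have [u u0 [ue u1 u2 u3]] : exists2 u, 0 < u &
    [/\ u <= e, u <= 1, u <= d / (4 * (X + 1)) & u <= (K2 - K1) * h / 4].
  have p1 : 0 < d / (4 * (X + 1)) by rewrite divr_gt0.
  have p2 : 0 < (K2 - K1) * h / 4 by rewrite divr_gt0.
  have [v v0 [v1 v2 v3]] := exists_small3 ltr01 p1 p2.
  have [u u0 [u1 u2 _]] := exists_small3 e0 v0 v0.
  by exists u => //; split => //; [apply: le_trans v1|apply: le_trans v2|apply: le_trans v3].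
have eh : 2 * e < h by move: h0 e1; clear; lra.
have ts1 : t1 < s1 by rewrite /s1 ltrDl.
pose N (y : 'rV[R]_n) := forall x : 'rV[R]_n,
  (forall i, `|x ord0 i - y ord0 i| <= 3 * e) -> U x.
(* The centres whose kernels, also after a shift back by u, fit between s1 = t1 + h and T. Time is
   cut at t0 without a margin above, as it is only ever moved back. *)
pose E := [set p : 'rV[R]_n * R | N p.1 /\ t1 + 4 * h <= p.2 <= t0].
have Et p : E p -> s1 < p.2 - u - h - e /\ p.2 + e < T.
  move=> [_ /andP[q1 q2]]; rewrite /s1; split.
    by move: q1 ue e1 e0 h0; clear; lra.
  by move: q2 e1 h0 h3; clear; lra.
have Ecyl p (z : 'rV[R]_n * R) : E p -> (forall j, `|z.1 ord0 j - p.1 ord0 j| <= e) ->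
    p.2 - h - e <= z.2 <= p.2 + e -> cylinder U t1 t2 z.
  move=> Ep zp /andP[q1 q2]; have [st te] := Et p Ep; split.
    apply: Ep.1 => i; apply: le_trans (zp i) _; by move: e0; clear; lra.
  rewrite /= in_itv /=; apply/andP; split.
    by move: q1 st ts1 u0; clear; lra.
  by move: q2 te Tt2; clear; lra.
pose P (p : 'rV[R]_n * R) := pressure_mean m w A h p.1 p.2.
have Pmean_le p (c : R) : E p -> 0 <= c ->
    (forall z : 'rV[R]_n * R, (forall j, `|z.1 ord0 j - p.1 ord0 j| <= e) ->
    p.2 - h - e <= z.2 <= p.2 + e -> w z `^ m <= c) -> P p <= c * (h + 2 * e).
  move=> Ep c0 wc; have [st te] := Et p Ep.
  exact: (pressure_mean_le m0 sub wW ts1 s1T Tt2 e0 eh sA hA A0 A1 Ep.1 u0 st te c0 wc).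
have powWm z : cylinder U t1 t2 z -> w z `^ m <= W `^ m.
  by move=> zC; apply: ge0_ler_powR; rewrite ?nnegrE ?(ltW m0) ?w_ge0 ?wW.
have E0 : E (x0, t0).
  have [H1 H2] := Hr _ (sQ _ z0) (ltW t0T) (ltW (lt_trans M12 M2w)).
  split; last by rewrite lexx andbT /=; move: H2 h1 h0 => /=; clear; lra.
  move=> x xx; apply: H1 => i; apply: le_lt_trans (xx i) _.
  by move: h1 e1 h0; clear; lra.
have bound p : E p -> P p - d * p.2 <= W `^ m * (h + 2 * e) - d * t1.
  move=> Ep; apply: lerB.
    by apply: Pmean_le => // [|z zp zt]; [exact: powR_ge0|apply: powWm; exact: (Ecyl p)].
  by rewrite ler_pM2l//; have [_ /andP[q1 _]] := Ep; move: q1 h0; clear; lra.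
have u30 : 0 < u ^+ 3 by rewrite exprn_gt0.
have [[y t] Ep Hmax] := near_sup (ex_intro _ _ E0) bound u30.
have [/= st te] := Et _ Ep.
have u3u : u ^+ 3 <= u.
  by rewrite -[leRHS]expr1; apply: ler_wiXn2l => //; exact: ltW.
(* Otherwise (x0, t0), where the mean is at least K2 (h - 2 e), would beat (y, t) in spite of the
   penalty. *)
have PyE : P (y, t) > K1 * (h + 2 * e).
  rewrite ltNge; apply/negP => Pyt.
  have P0 : K2 * (h - 2 * e) <= P (x0, t0).
    have [st0 te0] := Et _ E0.
    apply: (pressure_mean_ge m0 sub wW ts1 s1T Tt2 e0 eh sA hA A0 A1 E0.1 u0 st0 te0 K20).
    move=> z zp zt; have zC := Ecyl _ _ E0 zp zt.
    apply: ge0_ler_powR; rewrite ?nnegrE ?(ltW m0) ?w_ge0//.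
    have zz : ball (x0, t0) da z.
      split; first by apply/ball_rVE; split => // i; rewrite distrC;
         apply: le_lt_trans (zp i) _; move: h2 e1 h0; clear; lra.
      rewrite /ball /= distrC ltr_distl.
      by move: zt h2 e1 h0 => /= /andP[]; clear => *; apply/andP; split; lra.
    have := Hda _ _ (sQ _ z0) (sQ _ zC) zz; rewrite -/w0 => /ltr_normlW.
    by clear; lra.
  have Hm := Hmax _ E0.
  apply: (mean_contradiction K12 h0 _ _ _ P0 Pyt Hm).
  - have : e * (16 * (K1 + K2 + 1)) <= (K2 - K1) * h.
      by rewrite -ler_pdivlMr// mulr_gt0.
    by move: e0; clear; nra.
  - have [_ /andP[q1 q2]] := Ep.
    have <- : d * (4 * (t2 - t1)) = (K2 - K1) * h by rewrite /d divfK// gt_eqF// mulr_gt0.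
    rewrite mulrCA ler_wpM2l ?(ltW d0)//.
    by move: q1 q2 h0 t0T Tt2 => /=; clear; lra.
  - by move: u3 u3u; clear; lra.
(* The support of the kernel at (y, t) meets the set w >= M1. Its distance r from the boundary is
   large against h and e, so the shifted centres are still in E. *)
have [z zy [zt zM]] : exists2 z : 'rV[R]_n * R, (forall j, `|z.1 ord0 j - y ord0 j| <= e) &
    t - h - e <= z.2 <= t + e /\ M1 <= w z.
  apply: contrapT => nz; move: PyE; rewrite ltNge => /negP; apply.
  apply: Pmean_le => // z zy zt; have zC := Ecyl _ _ Ep zy zt.
  apply: ge0_ler_powR; rewrite ?nnegrE ?(ltW m0) ?w_ge0//.
  by rewrite leNgt; apply/negP => H; apply: nz; exists z => //; split => //; exact: ltW.
have zC := Ecyl _ _ Ep zy zt.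
have zT : z.2 <= T by move: zt te => /andP[_]; clear; lra.
have [zr zr2] := Hr _ (sQ _ zC) zT zM.
have Nnear (v : R) i : `|v| <= e -> E (v *: delta_mx ord0 i + y, t).
  move=> ve; split => /=; last by have [] := Ep.
  (* 3 e from the definition of E, e for the shift, and e between y and z. *)
  move=> x xx; apply: zr => j; apply: le_lt_trans (_ : 5 * e < r); last first.
    by move: h1 e1 h0; clear; lra.
  have := xx j; have := zy j; rewrite !mxE eqxx /= => p1 p2.
  have p3 : `|v * (j == i)%:R| <= e.
    by case: (j == i); rewrite ?mulr1// mulr0 normr0 ltW.
  have -> : x ord0 j - z.1 ord0 j =
    (x ord0 j - (v * (j == i)%:R + y ord0 j)) + v * (j == i)%:R + - (z.1 ord0 j - y ord0 j) by ring.
  apply: le_trans (ler_normD _ _) _; rewrite normrN.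
  have := ler_normD (x ord0 j - (v * (j == i)%:R + y ord0 j)) (v * (j == i)%:R).
  by move: p1 p2 p3; clear; lra.
have ue' : `|u| <= e by rewrite ger0_norm// ltW.
have ume' : `|- u| <= e by rewrite normrN.
have Hplus i : pressure_mean m w A h (u *: delta_mx ord0 i + y) t <=
    pressure_mean m w A h y t + u ^+ 3.
  by have := Hmax _ (Nnear u i ue'); rewrite addrAC lerD2r.
have Hminus i : pressure_mean m w A h ((- u) *: delta_mx ord0 i + y) t <=
    pressure_mean m w A h y t + u ^+ 3.
  by have := Hmax _ (Nnear (- u) i ume'); rewrite addrAC lerD2r.
(* The point z lies at least r >= 16 h after t1 and at most e after t, so t - u stays above t1 + 4
   h. *)
have Ept : E (y, t - u).
  have [Ny /andP[q1 q2]] := Ep; split => //=; apply/andP; split.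
    by move: zt zr2 h1 e1 h0 ue => /andP[]; clear; lra.
  by move: q2 u0 => /=; clear; lra.
have Htime : pressure_mean m w A h y (t - u) + d * u <= pressure_mean m w A h y t + u ^+ 3.
  have := Hmax _ Ept; rewrite /P /= mulrBr opprB addrA [leRHS]addrAC -[leLHS]addrA.
  by rewrite (addrC (d * u)) addrA [leLHS]addrAC lerD2r.
have Cyt : cylinder U t1 t2 (y, t).
  apply: (Ecyl (y, t)) => //=; first by move=> j; rewrite subrr normr0 ltW.
  by move: e0 h0; clear => *; apply/andP; split; lra.
have Cyth : cylinder U t1 t2 (y, t - h).
  apply: (Ecyl (y, t)) => //=; first by move=> j; rewrite subrr normr0 ltW.
  by move: e0 h0; clear => *; apply/andP; split; lra.
(* Here continuity of w enters: on the support of a bump w differs by at most o from its value at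
   the centre. *)
have near (c : R) (z' : 'rV[R]_n * R) : t - h <= c <= t -> cylinder U t1 t2 (y, c) ->
    (forall j, `|z'.1 ord0 j - y ord0 j| <= e) -> `|z'.2 - c| <= e ->
    cylinder U t1 t2 z' /\ `|w z' - w (y, c)| <= o.
  move=> /andP[c1 c2] Cc z'y z'c.
  have Cz' : cylinder U t1 t2 z'.
    apply: (Ecyl (y, t)) => //=; move: z'c; rewrite ler_distl => /andP[].
    by move: c1 c2; clear => *; apply/andP; split; lra.
  split => //; rewrite distrC ltW//; apply: Hdb; [exact: sQ|exact: sQ|].
  have edb : e < db by move: e2 e0; clear; lra.
  split; last by rewrite /ball /= distrC; exact: le_lt_trans z'c edb.
  by apply/ball_rVE; split => // i; rewrite distrC; apply: le_lt_trans (z'y i) edb.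
pose w1 := w (y, t - h); pose w2 := w (y, t).
have w10 : 0 <= w1 by exact: w_ge0.
have w20 : 0 <= w2 by exact: w_ge0.
have lip a b : 0 <= a -> 0 <= b -> a <= W -> b <= W -> `|a - b| <= o ->
    `|a `^ m - b `^ m| <= L * o.
  move=> a0 b0 aW bW; wlog ab : a b a0 b0 aW bW / a <= b => [H|].
    have [ab|/ltW ab] := leP a b; first exact: H.
    by rewrite distrC [in X in _ -> X]distrC; exact: H.
  rewrite distrC ger0_norm ?subr_ge0// => abo.
  rewrite distrC ger0_norm; last first.
    by rewrite subr_ge0 ge0_ler_powR ?nnegrE// ltW.
  by apply: le_trans (powR_lipschitz m1 a0 ab bW) _; rewrite ler_wpM2l.
have th : t - h <= t - h <= t by move: h0; clear => *; apply/andP; split; lra.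
have tt : t - h <= t <= t by move: h0; clear => *; apply/andP; split; lra.
have := near_maximum_comparison m0 sub wW ts1 s1T Tt2 e0 eh sA hA A0 A1 B1 bB bC2 bC3
  Ep.1 u0 ue u1 st te (a1 := w1 `^ m - L * o) (a2 := w2 `^ m + L * o)
  (b1 := w1 + o) (b2 := w2 - o) Hplus Hminus Htime.
case.
- move=> z' z'y z'c; have [Cz' H] := near _ z' th Cyth z'y z'c.
  have := lip _ _ (w_ge0 _ Cz') w10 (wW _ Cz') (wW _ Cyth) H.
  by move: H; rewrite !ler_distl => /andP[_ H2'] /andP[H1' _]; split.
- move=> z' z'y z'c; have [Cz' H] := near _ z' tt Cyt z'y z'c.
  have := lip _ _ (w_ge0 _ Cz') w20 (wW _ Cz') (wW _ Cyt) H.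
  by move: H; rewrite !ler_distl => /andP[H2' _] /andP[_ H1']; split.
move=> c1 c2; apply: (@comparison_contradiction R n d L o u Ct Cs (w1 `^ m) (w2 `^ m) w1 w2) => //.
- exact: ltW.
- exact: ltW.
- have : o * (8 * (L + 1)) = d by rewrite /o divfK// gt_eqF// mulr_gt0.
  by move: o0; clear; nra.
- have : u * (4 * (X + 1)) <= d by rewrite -ler_pdivlMr.
  have : (Ct + L * (Cs *+ n)) * u <= X * u by rewrite ler_wpM2r ?(ltW u0)// ler_norm.
  by move: u0; clear; nra.
- by move=> w12; apply: powR_lipschitz => //; exact: wW.
- by move=> w21; apply: ge0_ler_powR; rewrite ?nnegrE// ltW.
Qed.

(** * Supercaloric functions *)

Section supercaloric_functions.
Context {R : realType} {n : nat}.
Variables (m : R) (Omega : set 'rV[R]_n) (T : R).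
Hypotheses (m1 : 1 < m) (Omega_bounded : bounded_set Omega).
Local Notation Omega_T := (cylinder Omega 0 T).

Lemma bounded_cylinder_box : exists B : R, Omega_T `<=` closed_box 0 B `*` `[0, T].
Proof.
have [B [_ HB]] := Omega_bounded.
have B1 : B < B + 1 by rewrite ltrDl.
exists (B + 2) => z [/(HB _ B1) z1 z2]; split; last first.
  by move: z2; rewrite /= !in_itv /= => /andP[p q]; rewrite !ltW.
have : ball (0 : 'rV[R]_n) (B + 2) z.1.
  by rewrite -ball_normE /ball_ /= sub0r normrN (le_lt_trans z1)// ltrD2l ltr1n.
by move=> /ball_rVE [_ H] i; rewrite distrC ltW.
Qed.

(** The comparison condition offers cylinders whose closure lies in Omega_T; boundedness of Omega
    and Heine-Borel make this closure compact. *)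
Lemma compact_closure_cylinder (U : set 'rV[R]_n) (t1 t2 : R) :
  closure (cylinder U t1 t2) `<=` Omega_T -> compact (closure (cylinder U t1 t2)).
Proof.
move=> UO; have [B HB] := bounded_cylinder_box.
apply: (@subclosed_compact _ _ (closed_box 0 B `*` `[0, T])).
- exact: closed_closure.
- by apply: compact_setX; [exact: compact_closed_box|exact: segment_compact].
- exact: subset_trans UO HB.
Qed.

Lemma supercaloric_cst (C : R) : 0 <= C -> supercaloric m Omega T (fun=> C%:E).
Proof.
move=> C0; split.
- by move=> z _; rewrite lee_fin.
- move=> z a aC; exists setT => //; exact: filterT.
- by move=> z zO; apply: subset_closure; split => //; exact: ltry.
- move=> U t1 t2 w oU t12 UO cw [_ sub] wC z zU; rewrite lee_fin.
  apply: (subsolution_max_principle oU m1 C0 t12 _ cw sub _ zU).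
    exact: compact_closure_cylinder.
  by move=> y /wC; rewrite lee_fin.
Qed.

(** Such points are approached from inside U at slightly later times. This places the parabolic
    boundary in Omega_T. *)
Lemma parabolic_boundary_sub_closure (U : set 'rV[R]_n) (t1 t2 : R) : t1 < t2 ->
  parabolic_boundary U t1 t2 `<=` closure (cylinder U t1 t2).
Proof.
move=> t12.
have H (z : 'rV[R]_n * R) : closure U z.1 -> t1 <= z.2 < t2 -> closure (cylinder U t1 t2) z.
  move=> zU /andP[zt1 zt2] N /nbhs_ballP[r /= r0 rN].
  have [x [Ux xz]] := zU _ (nbhsx_ballx z.1 r r0).
  have t20 : 0 < t2 - z.2 by rewrite subr_gt0.
  have [d d0 [d1 d2 _]] := exists_small3 r0 t20 r0.
  exists (x, z.2 + d / 2); split.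
    split => //=; rewrite in_itv /=; apply/andP; split.
      by rewrite (le_lt_trans zt1)// ltrDl divr_gt0.
    by move: d0 d2; lra.
  apply: rN; split => //; rewrite /ball /= opprD addrA subrr sub0r normrN.
  by rewrite ger0_norm ?divr_ge0 ?ltW//; move: d0 d1; lra.
move=> z [[[zU _]]|[zU z2]]; last by apply: H => //; rewrite z2 lexx.
by rewrite /= in_itv /= => /andP[p q]; apply: H; rewrite ?(ltW p).
Qed.

Definition inf_envelope (S : set ('rV[R]_n * R -> \bar R)) (z : 'rV[R]_n * R) : \bar R :=
  ereal_inf [set v z | v in S].

(** The lower limit of f along A with the centre included; on A it is the largest lower
    semicontinuous minorant of f. *)
Definition lsc_envelope (A : set ('rV[R]_n * R)) (f : 'rV[R]_n * R -> \bar R)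
    (z : 'rV[R]_n * R) : \bar R :=
  ereal_sup [set ereal_inf (f @` (A `&` ball z r)) | r in [set r : R | 0 < r]].

Lemma lsc_envelope_le A f z : A z -> (lsc_envelope A f z <= f z)%E.
Proof.
move=> Az; apply: ge_ereal_sup => _ [r r0 <-].
by apply: ereal_inf_lbound; exists z => //; split => //; exact: ballxx.
Qed.

Lemma lsc_envelope_ge A f z (r : R) (c : \bar R) : 0 < r ->
  (forall y, A y -> ball z r y -> (c <= f y)%E) -> (c <= lsc_envelope A f z)%E.
Proof.
move=> r0 H; apply: le_trans (ereal_sup_ubound _); last by exists r.
by apply: le_ereal_inf_tmp => _ [y [Ay zy] <-]; exact: H.
Qed.

Lemma lsc_envelope_lsc A f : lower_semicontinuous_on A (lsc_envelope A f).
Proof.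
move=> z0 a; pose z : 'rV[R]_n * R := z0; rewrite -[z0]/z => az.
(* Points outside A are isolated in the subspace topology, so a singleton is a neighbourhood. *)
have [Az|nAz] := pselect (A z); last first.
  exists [set z]; last by move=> y ->.
  by case: (nbhs_subspaceP A z) => // _ y ->.
have /ereal_sup_gt[_ [r r0 <-] ar] := az.
have r20 : 0 < r / 2 by rewrite divr_gt0.
exists (ball z (r / 2)).
  have H : within A (nbhs z) (ball z (r / 2)).
    by apply: (@filterS _ (nbhs z) _ (ball z (r / 2))) => //; exact: nbhsx_ballx.
  by case: (nbhs_subspaceP A z).
move=> y zy; apply: (lt_le_trans ar).
apply: (lsc_envelope_ge r20) => x Ax yx; apply: ereal_inf_lbound.
by exists x => //; split => //; rewrite (splitr r); exact: ball_triangle zy yx.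
Qed.

(** Near z, f >= g > g z - e on A. This keeps the envelope above the obstacle, by the lower
    semicontinuity of [psi]. *)
Lemma lsc_le_lsc_envelope A f (g : 'rV[R]_n * R -> R) z :
  lower_semicontinuous_on A (EFin \o g) -> A z ->
  (forall y, A y -> ((g y)%:E <= f y)%E) -> ((g z)%:E <= lsc_envelope A f z)%E.
Proof.
move=> lg Az gf; apply/lee_addgt0Pr => e e0.
have ge : ((g z - e)%:E < (EFin \o g) z)%E by rewrite lte_fin ltrBlDr ltrDl.
have [V nV HV] := lg z (g z - e) ge.
have [r /= r0 rV] : exists2 r : R, 0 < r & forall y, ball z r y -> A y -> V y.
  move: nV; case: (nbhs_subspaceP A z) => // _ /nbhs_ballP[r /= r0 rV].
  by exists r.
have : ((g z - e)%:E <= lsc_envelope A f z)%E.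
  apply: (lsc_envelope_ge r0) => y Ay zy; apply: le_trans (gf y Ay).
  by apply/ltW/HV; exact: rV.
by rewrite EFinB leeBlDr.
Qed.

Lemma supercaloric_lsc_envelope_inf (S : set ('rV[R]_n * R -> \bar R)) (C : R) :
  (forall v, S v -> supercaloric m Omega T v) -> S (fun=> C%:E) ->
  supercaloric m Omega T (lsc_envelope Omega_T (inf_envelope S)).
Proof.
move=> HS SC; split.
- move=> z zO; apply: (lsc_envelope_ge ltr01) => y yO _.
  by apply: le_ereal_inf_tmp => _ [v Sv <-]; have [v0 _ _ _] := HS v Sv; exact: v0.
- exact: lsc_envelope_lsc.
- move=> z zO; apply: subset_closure; split => //.
  apply: le_lt_trans (lsc_envelope_le _ zO) _; apply: le_lt_trans (ltry C).
  by apply: ereal_inf_lbound; exists (fun=> C%:E).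
- move=> U t1 t2 w oU t12 UO cw sw wu z zU.
  (* The envelope is known to lie below the infimum on Omega_T, so the boundary values must be taken
     there. *)
  have bdO : parabolic_boundary U t1 t2 `<=` Omega_T.
    exact: subset_trans (parabolic_boundary_sub_closure t12) UO.
  have winf y : cylinder U t1 t2 y -> ((w y)%:E <= inf_envelope S y)%E.
    move=> yU; apply: le_ereal_inf_tmp => _ [v Sv <-].
    have [_ _ _ Hv] := HS v Sv; apply: (Hv U t1 t2) => // x xb.
    apply: le_trans (wu x xb) _; apply: le_trans (lsc_envelope_le _ (bdO x xb)) _.
    by apply: ereal_inf_lbound; exists v.
  have oC : open (cylinder U t1 t2).
    apply: (@openI _ (fst @^-1` U) (snd @^-1` `]t1, t2[%classic)).
      by apply: open_comp => // x _; exact: cvg_fst.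
    by apply: open_comp; [move=> x _; exact: cvg_snd|exact: itv_open].
  have sC : cylinder U t1 t2 `<=` closure (cylinder U t1 t2) by exact: subset_closure.
  apply/lee_addgt0Pr => e e0.
  have Hz : nbhs z (cylinder U t1 t2) by exact: open_nbhs_nbhs.
  have /nbhs_ballP[r /= r0 Hr] : nbhs z (cylinder U t1 t2 `&`
      [set y | closure (cylinder U t1 t2) y -> `|w z - w y| < e]).
    exact: filterI Hz (within_continuous_near cw (sC _ zU) e0).
  have : ((w z - e)%:E <= lsc_envelope Omega_T (inf_envelope S) z)%E.
    apply: (lsc_envelope_ge r0) => y _ /Hr[yU /(_ (sC _ yU)) wy].
    apply: le_trans (winf y yU); rewrite lee_fin.
    by move: wy; rewrite ltr_norml => /andP[_]; lra.
  by rewrite EFinB leeBlDr.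
Qed.

End supercaloric_functions.

(** * Existence and uniqueness for the obstacle problem *)

Unset Implicit Arguments.

Theorem theorem4p1 (R : realType) (n : nat) (m : R) (Omega : set 'rV[R]_n)
    (T : R) (psi : 'rV[R]_n * R -> R) (hm : 1 < m)
    (Omega_open : open Omega) (Omega_bounded : bounded_set Omega) (hT : 0 < T)
    (psi_ge0 : forall z, cylinder Omega 0 T z -> 0 <= psi z)
    (psi_bounded : exists M : R, forall z, cylinder Omega 0 T z -> psi z <= M)
    (psi_lsc : lower_semicontinuous_on (cylinder Omega 0 T) (EFin \o psi)) :
  exists u : 'rV[R]_n * R -> \bar R,
    obstacle_solution m Omega T psi u /\
    forall u' : 'rV[R]_n * R -> \bar R, obstacle_solution m Omega T psi u' ->
      forall z, cylinder Omega 0 T z -> u' z = u z.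
Proof.
have [M psiM] := psi_bounded.
pose S := [set v : 'rV[R]_n * R -> \bar R | supercaloric m Omega T v /\
  forall z, cylinder Omega 0 T z -> ((psi z)%:E <= v z)%E].
(* The absolute value supplies the nonnegative constant that [supercaloric_cst] asks for; M itself
   could be negative if Omega is empty. *)
have SC : S (fun=> `|M|%:E).
  split; first exact: supercaloric_cst.
  by move=> z /psiM zM; rewrite lee_fin (le_trans zM)// ler_norm.
pose u := lsc_envelope (cylinder Omega 0 T) (inf_envelope S).
have uS : S u.
  split; first by apply: (supercaloric_lsc_envelope_inf (C := `|M|)) => // v [].
  move=> z zO; apply: lsc_le_lsc_envelope => // y yO.
  by apply: le_ereal_inf_tmp => _ [v [_ psiv] <-]; exact: psiv.
have u_min v : S v -> forall z, cylinder Omega 0 T z -> (u z <= v z)%E.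
  move=> Sv z zO; apply: le_trans (lsc_envelope_le _ zO) _.
  by apply: ereal_inf_lbound; exists v.
exists u; split; first by split; [exact: uS.2|exact: uS.1|move=> v vs pv; exact: u_min].
move=> u' [psiu' su' u'_min] z zO; apply/eqP; rewrite eq_le; apply/andP; split.
  by apply: u'_min => //; [exact: uS.1|exact: uS.2].
exact: u_min.
Qed.
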